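(* Let $n\in\mathbb{N}$ and let $a,b,c$ be positive integers with $a<b<c$ and $\gcd(a,b,c)=1$. Then Algorithm 1 (the explicit six-step algorithm written out in the context) correctly computes the denumerant $d(n;a,b,c)$, with a computational complexity of $O(\log b)$.
   Context: **Denumerant.** $\mathbb{N}=\{0,1,2,\dots\}$. For $n\in\mathbb N$ and positive integers $a,b,c$ with $\gcd(a,b,c)=1$, $d(n;a,b,c)$ is the number of triples $(x_1,x_2,x_3)$ of non-negative integers with $ax_1+bx_2+cx_3=n$. **Complexity** counts ring operations; each (signed) remainder operation defined below costs $O(1)$. **Notation.** $z_1,z_2,z_3$ are slack variables, and $\mathbf z^{\mathbf m}=z_1^{m_1}z_2^{m_2}z_3^{m_3}$ for $\mathbf m\in\mathbb Q^3$. For $E(\lambda)=L(\lambda)/\prod_i(1-y_i\lambda^{a_i})$, with $L$ a Laurent polynomial and pairwise coprime denominator factors, $\mathrm{CT}_\lambda E$ with the factor $1-y_i\lambda^{a_i}$ ($a_i\ge1$) underlined means $A_i(0)$. Here $A_i(\lambda)$ is the polynomial of degree $<a_i$ with $A_i(\lambda)\equiv E(\lambda)(1-y_i\lambda^{a_i}) \bmod (1-y_i\lambda^{a_i})$. Put $$F(\underline{\lambda^{a}\mathbf z^{\alpha}},\lambda\mathbf z^{\gamma},\lambda^{c}\mathbf z^{\beta},\lambda^{r_1}\mathbf z^{\mathbf m_1},\lambda^{r_2}\mathbf z^{\mathbf m_2})=\mathrm{CT}_\lambda\frac{\lambda^{r_1}\mathbf z^{\mathbf m_1}-\lambda^{r_2}\mathbf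 z^{\mathbf m_2}}{\underline{(1-\lambda^a\mathbf z^\alpha)}(1-\lambda\mathbf z^\gamma)(1-\lambda^c\mathbf z^\beta)}.$$ When $a=0$ this is taken to be $0$. When $a=1$ it equals $\dfrac{\mathbf z^{\mathbf m_1-r_1\alpha}-\mathbf z^{\mathbf m_2-r_2\alpha}}{(1-\mathbf z^{\gamma-\alpha})(1-\mathbf z^{\beta-c\alpha})}$. These are the base cases. For an integer $m$ and $a\ge1$: $\mathrm{rem}^\star(\lambda^m,1-\mathbf z^{\mathbf h}\lambda^a,\lambda)=\mathbf z^{-\ell\mathbf h}\lambda^r$ where $m=\ell a+r$, $0<r\le a$; and $\mathrm{srem}^\star(\lambda^m,1-\mathbf z^{\mathbf h}\lambda^a,\lambda)=\mathbf z^{-\ell\mathbf h}\lambda^r$ where $m=\ell a+r$, $-a/2<r\le a/2$. **Recursive step (R).** Given $F(\underline{\lambda^{a}\mathbf z^{\alpha}},\lambda\mathbf z^{\gamma},\lambda^{c}\mathbf z^{\beta},\lambda^{r_1}\mathbf z^{\mathbf m_1},\lambda^{r_2}\mathbf z^{\mathbf m_2})$, let $\lambda^{c_1}\mathbf z^{\beta_1}=\mathrm{srem}^\star(\lambda^c,1-\mathbf z^\alpha\lambda^a,\lambda)\cdot\mathbf z^\beta$. - If $0\le c_1\le a/2$, set $(c_2,\beta_2)=(c_1,\beta_1)$, and for $j=1,2$ set $\lambda^{t_j}\mathbf z^{\mathbf m_j'}=\mathrm{rem}^\star(\lambda^{r_j},1-\lambda^a\mathbf z^\alpha,\lambda)\,\mathbf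 z^{\mathbf m_j}$. - If $-a/2<c_1<0$, set $(c_2,\beta_2)=(-c_1,-\beta_1)$, $\lambda^{t_1}\mathbf z^{\mathbf m_1'}=\mathrm{rem}^\star(\lambda^{r_2-c_1},1-\lambda^a\mathbf z^\alpha,\lambda)\,\mathbf z^{\mathbf m_2-\beta_1}$ and $\lambda^{t_2}\mathbf z^{\mathbf m_2'}=\mathrm{rem}^\star(\lambda^{r_1-c_1},1-\lambda^a\mathbf z^\alpha,\lambda)\,\mathbf z^{\mathbf m_1-\beta_1}$. Replace the given $F$ by $$\frac{\mathbf z^{\mathbf m_2'-t_2\gamma}-\mathbf z^{\mathbf m_1'-t_1\gamma}}{(1-\mathbf z^{\alpha-a\gamma})(1-\mathbf z^{\beta_2-c_2\gamma})}+F(\underline{\lambda^{c_2}\mathbf z^{\beta_2}},\lambda\mathbf z^\gamma,\lambda^a\mathbf z^\alpha,\lambda^{t_2}\mathbf z^{\mathbf m_2'},\lambda^{t_1}\mathbf z^{\mathbf m_1'}),$$ where $c_2\le a/2$. **Algorithm 1.** Input: $n\in\mathbb N$ and positive integers $a<b<c$ with $\gcd(a,b,c)=1$. Output: $d(n;a,b,c)$. 1. By the extended gcd algorithm compute non-zero integers $u,v$ with $au+bv=g_3=\gcd(a,b)$. With $c_3c\equiv1\pmod{g_3}$, $i\equiv nc_3\pmod{g_3}$, $0\le i<g_3$, use $d(n;a,b,c)=d\left(\frac{n-ic}{g_3};\frac a{g_3},\frac b{g_3},c\right)$ to replace $(n,a,b)$ by $\left(\frac{n-ic}{g_3},\frac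 a{g_3},\frac b{g_3}\right)$. Now $\gcd(a,b)=1$ and $ua+vb=1$. 2. Take the integer $s$ with $0<sc-n\le c$ and write $d(n;a,b,c)=\lim_{z_i\to1}(T(a)+T(b))$, where $T(a)$ and $T(b)$ are the constant terms in $\lambda$ of $\dfrac{\lambda^{-n}-\lambda^{sc-n}z_3^s}{(1-\lambda^az_1)(1-\lambda^bz_2)(1-\lambda^cz_3)}$ with only the factor $1-\lambda^az_1$, respectively only $1-\lambda^bz_2$, underlined. 3. For $T(a)$: since $\gcd(a,v)=1$, substitute $\lambda\mapsto\lambda^v$ everywhere except in the underlined factor, which becomes $1-\lambda^az_1^{1/v}$ (this leaves the constant term unchanged), and reduce $\lambda^{bv}=\lambda^{1-au}$ to get $$T(a)=\mathrm{CT}_\lambda\frac{\lambda^{-nv}-\lambda^{(sc-n)v}z_3^s}{\underline{(1-\lambda^az_1^{1/v})}(1-\lambda z_1^{u/v}z_2)(1-\lambda^{cv}z_3)}.$$ Then apply (R) iteratively, at most $\log a$ times, until a base case is reached. This gives a sum $R_1$ of simple rational functions. 4. For $T(b)$: likewise, since $\gcd(b,u)=1$, with multiplier $u$, $$T(b)=\mathrm{CT}_\lambda\frac{\lambda^{-nu}-\lambda^{(sc-n)u}z_3^s}{\underline{(1-\lambda^bz_2^{1/u})}(1-\lambda z_1z_2^{v/u})(1-\lambda^{cu}z_3)}.$$ Apply (R) iteratively, at most $\log b$ times, until a base case is reached. This gives a sum $R_2$ of simple rational functions. 5. Form $R_1+R_2$, a sum of at most $\log a+\log b$ terms of the form $\dfrac{\mathbf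 z^{\mathbf m_1}-\mathbf z^{\mathbf m_2}}{(1-\mathbf z^{\omega})(1-\mathbf z^{\theta})}$. 6. Choose a vector $\mu=(\mu_1,\mu_2,\mu_3)$ (random vectors can be used) such that $\langle\omega,\mu\rangle\ne0$ and $\langle\theta,\mu\rangle\neq0$ for every term. Substitute $z_i\mapsto\kappa^{\mu_i}$, $\kappa\mapsto e^{x}$, and take the constant term in $x$ term by term: with $h_1=\langle\omega,\mu\rangle$, $h_2=\langle\theta,\mu\rangle$, $h_3=\langle\mathbf m_1,\mu\rangle$, $h_4=\langle\mathbf m_2,\mu\rangle$, each term contributes $$\mathrm{CT}_x\frac{e^{h_3x}-e^{h_4x}}{(1-e^{h_1x})(1-e^{h_2x})}=\frac{(h_4-h_3)(h_1+h_2-h_3-h_4)}{2h_1h_2}.$$ The sum of these contributions is output as $d(n;a,b,c)$. *)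

(* Defs.v *)
From HB Require Import structures.
From mathcomp Require Import all_boot all_order all_algebra.
From mathcomp Require Import zify.

Set Implicit Arguments.
Unset Strict Implicit.
Unset Printing Implicit Defensive.

Import Order.TTheory GRing.Theory Num.Theory.
Local Open Scope ring_scope.

(** * Denumerant *)

Definition denumerant (n a b c : nat) : nat :=
  #|[set x : 'I_n.+1 * 'I_n.+1 * 'I_n.+1 |
      (a * x.1.1 + b * x.1.2 + c * x.2 == n)%N]|.

(* For positive a, b, c, restricting the x_i to {0, ..., n} loses no solution. *)
Lemma denumerant_range (n a b c x1 x2 x3 : nat) :
  (0 < a)%N -> (0 < b)%N -> (0 < c)%N ->
  (a * x1 + b * x2 + c * x3 = n)%N ->
  [/\ (x1 < n.+1)%N, (x2 < n.+1)%N & (x3 < n.+1)%N].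
Proof.
move=> a0 b0 c0 e.
have := leq_pmull x1 a0; have := leq_pmull x2 b0; have := leq_pmull x3 c0.
by move=> h3 h2 h1; split; lia.
Qed.

(** * Computations that may fail and that count their operations *)

Definition comp (A : Type) := (option A * nat)%type.

Definition result A (m : comp A) : option A := m.1.
Definition cost A (m : comp A) : nat := m.2.

Definition ret A (x : A) : comp A := (Some x, 0%N).
Definition fail A : comp A := (None, 0%N).
Definition bind A B (m : comp A) (f : A -> comp B) : comp B :=
  if m.1 is Some x then ((f x).1, (m.2 + (f x).2)%N) else (None, m.2).

(* [op e] is only applied to an [e] that performs one operation on integers or
   rationals (a ring operation, a division, a remainder or a test), and [vop e]
   to an [e] that adds two vectors of rat^3 or multiplies one by a scalar. *)
Definition op A (x : A) : comp A := (Some x, 1%N).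
Definition vop (w : 'rV[rat]_3) : comp 'rV[rat]_3 := (Some w, 3%N).

Declare Scope comp_scope.
Delimit Scope comp_scope with C.
Notation "'let!' x ':=' m 'in' k" := (bind m (fun x => k))
  (at level 200, x strict pattern, m at level 200, k at level 200,
   format "'[v' 'let!'  x  ':='  m  'in' '//' k ']'") : comp_scope.
Local Open Scope comp_scope.

(** * Extended Euclidean algorithm *)

(* Invariants: r0 = x * u0 + y * v0 and r1 = x * u1 + y * v1 for the input
   (x, y).  [fuel] bounds the number of division steps. *)
Fixpoint egcd_loop (fuel : nat) (r0 u0 v0 r1 u1 v1 : int) :
    comp (int * int * int) :=
  let! stop := op (r1 == 0) in
  if stop then ret (r0, u0, v0) else
  if fuel is fuel'.+1 then
    let! q := op (r0 %/ r1)%Z in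
    let! r2 := op (r0 %% r1)%Z in
    let! qu := op (q * u1) in
    let! u2 := op (u0 - qu) in
    let! qv := op (q * v1) in
    let! v2 := op (v0 - qv) in
    egcd_loop fuel' r1 u1 v1 r2 u2 v2
  else fail _.

(* For x, y > 0, returns (g, u, v) with x * u + y * v = g = gcd(x, y). *)
Definition ext_gcd (x y : int) : comp (int * int * int) :=
  egcd_loop `|y|%N x 1 0 y 0 1.

(* Non-zero u, v with a * u + b * v = gcd(a, b), for 0 < a < b.  The Euclidean
   algorithm yields a zero coefficient only if a divides b, and then it is v. *)
Definition bezout_nz (a b : int) : comp (int * int * int) :=
  let! (g, v, u) := ext_gcd b a in
  let! v0 := op (v == 0) in
  if v0 then
    let! b' := op (b %/ g)%Z in
    let! u' := op (u - b') in
    let! a' := op (a %/ g)%Z in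
    let! v' := op (v + a') in
    ret (g, u', v')
  else ret (g, u, v).

(** * Monomials and the expressions F *)

(* (r, m) stands for lambda^r z^m; exponents of the slack variables are
   rational. *)
Definition monomial := (int * 'rV[rat]_3)%type.

Definition vec3 (x y z : rat) : 'rV[rat]_3 := \row_(i < 3) [:: x; y; z]`_i.

(* The data of
     F(_lambda^a z^alpha_, lambda z^gamma, lambda^c z^beta,
       lambda^r1 z^m1, lambda^r2 z^m2),
   where F_under = (a, alpha), F_gamma = gamma, F_other = (c, beta),
   F_num1 = (r1, m1) and F_num2 = (r2, m2). *)
Record Fexpr := MkF {
  F_under : monomial;
  F_gamma : 'rV[rat]_3;
  F_other : monomial;
  F_num1 : monomial;
  F_num2 : monomial }.

(* The rational function (z^m1 - z^m2) / ((1 - z^omega) (1 - z^theta)). *)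
Record term := MkTerm {
  t_m1 : 'rV[rat]_3;
  t_m2 : 'rV[rat]_3;
  t_omega : 'rV[rat]_3;
  t_theta : 'rV[rat]_3 }.

(** * Remainders *)

(* (l, r) with m = l * a + r and 0 < r <= a. *)
Definition div_star (m a : int) : int * int :=
  let l := ((m - 1) %/ a)%Z in (l, m - l * a).

(* (l, r) with m = l * a + r and - a / 2 < r <= a / 2. *)
Definition sdiv_star (m a : int) : int * int :=
  let l := (m %/ a)%Z in
  let r := (m %% a)%Z in
  if r *+ 2 <= a then (l, r) else (l + 1, r - a).

Lemma div_starP (m a : int) : 0 < a ->
  let: (l, r) := div_star m a in m = l * a + r /\ 0 < r <= a.
Proof. by rewrite /div_star => a0; split; lia. Qed.

Lemma sdiv_starP (m a : int) : 0 < a ->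
  let: (l, r) := sdiv_star m a in
  m = l * a + r /\ - a < r *+ 2 <= a.
Proof. by rewrite /sdiv_star => a0; case: ifP => h; split; lia. Qed.

(* rem*(lambda^m, 1 - z^h lambda^a, lambda), where d = (a, h). *)
Definition rem_star (m : int) (d : monomial) : comp monomial :=
  let! (l, r) := op (div_star m d.1) in
  let! k := op (- l) in
  let! w := vop (k%:~R *: d.2) in
  ret (r, w).

Definition srem_star (m : int) (d : monomial) : comp monomial :=
  let! (l, r) := op (sdiv_star m d.1) in
  let! k := op (- l) in
  let! w := vop (k%:~R *: d.2) in
  ret (r, w).

(** * The recursion *)

(* rem*(lambda^r, 1 - z^h lambda^a, lambda) z^m *)
Definition rem_mul (r : int) (d : monomial) (m : 'rV[rat]_3) : comp monomial :=
  let! (t, w) := rem_star r d in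
  let! m' := vop (w + m) in
  ret (t, m').

(* m - r * w *)
Definition shift (m : 'rV[rat]_3) (r : int) (w : 'rV[rat]_3) :
    comp 'rV[rat]_3 :=
  let! rw := vop (r%:~R *: w) in
  vop (m - rw).

Definition stepR (f : Fexpr) : comp (term * Fexpr) :=
  let: MkF (a, alpha) gamma (c, beta) (r1, m1) (r2, m2) := f in
  let! (c1, w) := srem_star c (a, alpha) in
  let! beta1 := vop (w + beta) in
  let! neg := op (c1 < 0) in
  let! (c2, beta2, (t1, m1'), (t2, m2')) :=
    (if neg then
       let! c2 := op (- c1) in
       let! beta2 := vop (- beta1) in
       let! e2 := op (r2 - c1) in
       let! n2 := vop (m2 - beta1) in
       let! p1 := rem_mul e2 (a, alpha) n2 in
       let! e1 := op (r1 - c1) in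
       let! n1 := vop (m1 - beta1) in
       let! p2 := rem_mul e1 (a, alpha) n1 in
       ret (c2, beta2, p1, p2)
     else
       let! p1 := rem_mul r1 (a, alpha) m1 in
       let! p2 := rem_mul r2 (a, alpha) m2 in
       ret (c1, beta1, p1, p2)) in
  let! x2 := shift m2' t2 gamma in
  let! x1 := shift m1' t1 gamma in
  let! omega := shift alpha a gamma in
  let! theta := shift beta2 c2 gamma in
  ret (MkTerm x2 x1 omega theta,
       MkF (c2, beta2) gamma (a, alpha) (t2, m2') (t1, m1')).

(* The value of F when a = 1. *)
Definition base1 (f : Fexpr) : comp term :=
  let: MkF (_, alpha) gamma (c, beta) (r1, m1) (r2, m2) := f in
  let! x1 := shift m1 r1 alpha in
  let! x2 := shift m2 r2 alpha in
  let! omega := vop (gamma - alpha) in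
  let! theta := shift beta c alpha in
  ret (MkTerm x1 x2 omega theta).

(* Applies stepR until a base case is reached, failing if more than [k]
   applications are needed.  The returned list stands for the sum of its
   elements. *)
Fixpoint iterR (k : nat) (f : Fexpr) : comp (seq term) :=
  let a := (F_under f).1 in
  let! is0 := op (a == 0) in
  if is0 then ret [::] else
  let! is1 := op (a == 1) in
  if is1 then
    let! t := base1 f in ret [:: t]
  else if k is k'.+1 then
    let! (t, f') := stepR f in
    let! ts := iterR k' f' in
    ret (t :: ts)
  else fail _.

Definition expandF (f : Fexpr) : comp (seq term) :=
  iterR (trunc_log 2 `|(F_under f).1|) f.

(** * The algorithm *)

(* Step 1: returns (u, v) and the new values of (n, a, b); the new n may be
   negative. *)
Definition reduce_input (n a b c : int) :
    comp (int * int * int * int * int) :=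
  let! (g3, u, v) := bezout_nz a b in
  let! (_, c3, _) := ext_gcd c g3 in
  let! nc3 := op (n * c3) in
  let! i := op (nc3 %% g3)%Z in
  let! ic := op (i * c) in
  let! nic := op (n - ic) in
  let! n' := op (nic %/ g3)%Z in
  let! a' := op (a %/ g3)%Z in
  let! b' := op (b %/ g3)%Z in
  ret (u, v, n', a', b').

(* The integer s with 0 < s * c - n <= c, together with s * c - n. *)
Definition choose_s (n c : int) : comp (int * int) :=
  let! q := op (n %/ c)%Z in
  let! s := op (q + 1) in
  let! sc := op (s * c) in
  let! e := op (sc - n) in
  ret (s, e).

(* T(a) after the substitution lambda -> lambda^v; e = s * c - n. *)
Definition Ta (u v n a c s e : int) : comp Fexpr :=
  let! v1 := op (v%:~R^-1 : rat) in
  let! uv := op (u%:~R / v%:~R : rat) in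
  let! cv := op (c * v) in
  let! nv := op (n * v) in
  let! r1 := op (- nv) in
  let! r2 := op (e * v) in
  ret (MkF (a, vec3 v1 0 0) (vec3 uv 1 0) (cv, vec3 0 0 1)
           (r1, 0) (r2, vec3 0 0 s%:~R)).

(* T(b) after the substitution lambda -> lambda^u; e = s * c - n. *)
Definition Tb (u v n b c s e : int) : comp Fexpr :=
  let! u1 := op (u%:~R^-1 : rat) in
  let! vu := op (v%:~R / u%:~R : rat) in
  let! cu := op (c * u) in
  let! nu := op (n * u) in
  let! r1 := op (- nu) in
  let! r2 := op (e * u) in
  ret (MkF (b, vec3 0 u1 0) (vec3 1 vu 0) (cu, vec3 0 0 1)
           (r1, 0) (r2, vec3 0 0 s%:~R)).

(* Steps 1 to 5: the terms of R_1 + R_2. *)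
Definition simple_terms (n a b c : nat) : comp (seq term) :=
  let! (u, v, n', a', b') := reduce_input n%:Z a%:Z b%:Z c%:Z in
  let! (s, e) := choose_s n' c%:Z in
  let! fa := Ta u v n' a' c%:Z s e in
  let! R1 := expandF fa in
  let! fb := Tb u v n' b' c%:Z s e in
  let! R2 := expandF fb in
  ret (R1 ++ R2).

Definition dot (w mu : 'rV[rat]_3) : rat := \sum_i w 0 i * mu 0 i.

(* Three products and two sums. *)
Definition cdot (w mu : 'rV[rat]_3) : comp rat := (Some (dot w mu), 5%N).

(* The constant term in x of
     (e^(h3 x) - e^(h4 x)) / ((1 - e^(h1 x)) (1 - e^(h2 x))). *)
Definition contribution (h1 h2 h3 h4 : rat) : comp rat :=
  let! p := op (h4 - h3) in
  let! q := op (h1 + h2) in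
  let! q3 := op (q - h3) in
  let! q4 := op (q3 - h4) in
  let! num := op (p * q4) in
  let! d1 := op (2%:R * h1) in
  let! den := op (d1 * h2) in
  op (num / den).

(* Step 6 for a proposed vector mu, failing if mu is orthogonal to some omega
   or theta. *)
Fixpoint evaluate (mu : 'rV[rat]_3) (ts : seq term) : comp rat :=
  if ts is t :: ts' then
    let! h1 := cdot (t_omega t) mu in
    let! bad1 := op (h1 == 0) in
    if bad1 then fail _ else
    let! h2 := cdot (t_theta t) mu in
    let! bad2 := op (h2 == 0) in
    if bad2 then fail _ else
    let! h3 := cdot (t_m1 t) mu in
    let! h4 := cdot (t_m2 t) mu in
    let! x := contribution h1 h2 h3 h4 in
    let! y := evaluate mu ts' in
    op (x + y)
  else ret 0.

Definition algorithm1 (mu : 'rV[rat]_3) (n a b c : nat) : comp rat :=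
  let! ts := simple_terms n a b c in
  evaluate mu ts.

(* The vectors mu that may be chosen in Step 6. *)
Definition admissible (mu : 'rV[rat]_3) (n a b c : nat) : Prop :=
  exists2 ts : seq term, result (simple_terms n a b c) = Some ts &
    all (fun t => (dot (t_omega t) mu != 0) && (dot (t_theta t) mu != 0)) ts.

(* Main.v *)
Require Import Defs.
From mathcomp Require Import all_boot all_order all_algebra all_field.
From mathcomp Require Import zify ring.

Set Implicit Arguments.
Unset Strict Implicit.
Unset Printing Implicit Defensive.

Import Order.TTheory GRing.Theory Num.Theory.
Local Open Scope ring_scope.

(* Put z^w = kappa^<w, mu> with kappa = 2, 3, 4, ..., using real roots of kappa
   for rational exponents.  The constant term with 1 - y lambda^a underlined is
   then the average, over the a roots of y lambda^a = 1, of the remaining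
   factors.  The sum of the residues of
     lambda^(t-1) / ((1 - y1 lambda^a1) (1 - y2 lambda^a2) (1 - y3 lambda^a3)),
   0 < t < a1 + a2 + a3, is zero; this exchange of the underlined factor is step
   (R), and with two factors it also identifies T(a) + T(b) with the generating
   polynomial of the solutions of a x1 + b x2 + c x3 = n.  Up to sign, the
   determinant of (a, <alpha, mu>) and (c, <beta, mu>) does not change in (R),
   so the admissibility of mu for the final terms already makes all the factors
   met on the way coprime.  The equality between the sum of the simple terms and
   the generating polynomial thus holds at every integer kappa >= 2, so it is an
   identity between rational functions of kappa; comparing first-order jets at
   kappa = 1 compares the constant terms in x after kappa = e^x.  The
   denominators do not vanish identically because alpha - a gamma and
   beta - c gamma stay linearly independent. *)

(** * Residues and averages over roots *)

(** Lagrange interpolation at [rs] reproduces [p]; the sum is the coefficient of degree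
    [size rs - 1] of the interpolant, zero by the bound on [size p]. *)
Lemma sum_residues (K : fieldType) (rs : seq K) (p : {poly K}) :
  uniq rs -> (size p < size rs)%N ->
  \sum_(r <- rs) p.[r] / (\prod_(s <- rs) ('X - s%:P))^`().[r] = 0.
Proof.
move=> urs sz_p.
pose q r := \prod_(s <- rem r rs) ('X - s%:P).
have dq r : r \in rs -> (\prod_(s <- rs) ('X - s%:P))^`().[r] = (q r).[r].
  move=> rrs; rewrite (perm_big _ (perm_to_rem rrs)) big_cons.
  by rewrite derivM !hornerE /= subrr mul0r addr0 derivXsubC hornerE mul1r.
have qr0 r : r \in rs -> (q r).[r] != 0.
  move=> rrs; rewrite horner_prod prodf_seq_neq0; apply/allP => s.
  rewrite mem_rem_uniq // inE => /andP[sr _] /=.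
  by rewrite !hornerE subr_eq0 eq_sym.
have qs0 r s : r \in rs -> s \in rs -> s != r -> (q r).[s] = 0.
  move=> rrs srs sr; apply/eqP; rewrite -/(root _ _) root_prod_XsubC.
  by rewrite mem_rem_uniq // inE sr.
have sz_q r : r \in rs -> size (q r) = size rs.
  by move=> rrs; rewrite size_prod_XsubC (perm_size (perm_to_rem rrs)).
pose P := \sum_(r <- rs) (p.[r] / (q r).[r]) *: q r.
have hP s : s \in rs -> P.[s] = p.[s].
  move=> srs; rewrite /P horner_sum (bigD1_seq s) //= hornerZ divfK ?qr0 //.
  rewrite big_seq_cond big1 ?addr0 // => r /andP[rrs rs'].
  by rewrite hornerZ (qs0 r s rrs srs) ?mulr0 // eq_sym.
have szP : (size P <= size rs)%N.
  rewrite /P big_seq; apply: (big_ind (fun P : {poly K} => (size P <= size rs)%N)).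
  - by rewrite size_poly0.
  - by move=> x y hx hy; rewrite (leq_trans (size_polyD _ _)) // geq_max hx.
  - by move=> r rrs; rewrite (leq_trans (size_scale_leq _ _)) // sz_q.
have PE : P = p.
  apply/eqP; rewrite -subr_eq0; apply/eqP/(@roots_geq_poly_eq0 _ _ rs) => //.
    by apply/allP => s srs; rewrite rootE !hornerE hP // subrr.
  rewrite (leq_trans (size_polyD _ _)) // size_polyN geq_max szP.
  exact: ltnW.
transitivity (P`_(size rs).-1); last first.
  by rewrite PE nth_default //; case: (size rs) sz_p.
rewrite /P coef_sum; apply: eq_big_seq => r rrs.
rewrite coefZ dq // -(sz_q _ rrs) -lead_coefE.
by rewrite (eqP (monic_prod_XsubC _ _ _)) mulr1.
Qed.

Definition binom (a : nat) (y : algC) : {poly algC} := 1 - y *: 'X^a.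

Definition binom_roots (a : nat) (y : algC) : seq algC :=
  sval (closed_field_poly_normal (binom a y)).

(* The constant term in lambda of f (lambda) / (1 - y lambda^a) with the
   denominator underlined, for a > 0 and y != 0; for a = 0 it is 0 because
   0^-1 = 0, in agreement with the base case of F. *)
Definition avg (a : nat) (y : algC) (f : algC -> algC) : algC :=
  a%:R^-1 * \sum_(r <- binom_roots a y) f r.

Lemma horner_binom a y r : (binom a y).[r] = 1 - y * r ^+ a.
Proof. by rewrite /binom !hornerE. Qed.

Lemma size_binom a y : (0 < a)%N -> y != 0 -> size (binom a y) = a.+1.
Proof.
move=> a0 y0; rewrite /binom addrC size_polyDl size_polyN size_scale ?size_polyXn //.
by rewrite size_poly1.
Qed.

Lemma binomE a y :
  binom a y = lead_coef (binom a y) *: \prod_(r <- binom_roots a y) ('X - r%:P).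
Proof. by rewrite /binom_roots; case: closed_field_poly_normal. Qed.

Lemma binom_rootsP a y r :
  binom a y != 0 -> (r \in binom_roots a y) = (y * r ^+ a == 1).
Proof.
move=> p0; rewrite -root_prod_XsubC -(@rootZ _ _ (lead_coef (binom a y))).
  by rewrite -binomE rootE horner_binom subr_eq0 eq_sym.
by rewrite lead_coef_eq0.
Qed.

Lemma binom_neq0 a y : (0 < a)%N -> binom a y != 0.
Proof.
move=> a0; apply/eqP => /(congr1 (fun p : {poly algC} => p.[0])).
by rewrite horner_binom expr0n (gtn_eqF a0) mulr0 subr0 horner0; apply/eqP/oner_neq0.
Qed.

Lemma binom0_neq0 y : y != 1 -> binom 0 y != 0.
Proof.
move=> y1; apply/eqP => /(congr1 (fun p : {poly algC} => p.[0])) /eqP.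
by rewrite horner_binom expr0 mulr1 horner0 subr_eq0 eq_sym (negbTE y1).
Qed.

Lemma binom_root_neq0 a (y r : algC) : (0 < a)%N -> y * r ^+ a = 1 -> r != 0.
Proof.
move=> a0; apply: contra_eq_neq => ->.
by rewrite expr0n gtn_eqF // mulr0 eq_sym oner_neq0.
Qed.

Lemma deriv_binom a y : (binom a y)^`() = - (y * a%:R) *: 'X^(a.-1).
Proof.
by rewrite /binom derivB derivZ derivXn derivC sub0r scaleNr -scalerMnr scalerMnl mulr_natr.
Qed.

(** For p = 1 - y X^a, the Bezout relation p - (X / a) p' = 1 makes p separable. *)
Lemma binom_roots_uniq a y : (0 < a)%N -> y != 0 -> uniq (binom_roots a y).
Proof.
move=> a0 y0; rewrite -separable_prod_XsubC.
have lc0 : lead_coef (binom a y) != 0 by rewrite lead_coef_eq0 binom_neq0.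
rewrite -(eqp_separable (eqp_scale _ lc0)) -binomE.
rewrite unlock; apply/Bezout_coprimepP.
exists (1, - (a%:R^-1)%:P * 'X) => /=.
rewrite deriv_binom /binom mul1r !mulNr scaleNr mulrN opprK -mulrA -scalerAr.
rewrite -exprS prednK // mul_polyC scalerA mulrCA mulVf ?pnatr_eq0 -?lt0n //.
by rewrite mulr1 subrK eqpxx.
Qed.

Lemma size_binom_roots a y : (0 < a)%N -> y != 0 -> size (binom_roots a y) = a.
Proof.
move=> a0 y0; apply: succn_inj; rewrite -[in RHS](size_binom a0 y0) binomE.
by rewrite size_scale ?size_prod_XsubC // lead_coef_eq0 binom_neq0.
Qed.

Lemma binom_roots0 y : y != 1 -> binom_roots 0 y = [::].
Proof.
move=> y1; have := binom_rootsP _ (binom0_neq0 y1); case: (binom_roots 0 y) => // r s.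
by move/(_ r); rewrite expr0 mulr1 (negbTE y1) mem_head.
Qed.

Lemma avg0 y f : avg 0 y f = 0.
Proof. by rewrite /avg invr0 mul0r. Qed.

Lemma eq_avg a y f g :
  (forall r, y * r ^+ a = 1 -> f r = g r) -> avg a y f = avg a y g.
Proof.
case: a => [|a] fg; first by rewrite !avg0.
congr (_ * _); apply: eq_big_seq => r; rewrite binom_rootsP ?binom_neq0 //.
by move/eqP/fg.
Qed.

Lemma avgD a y f g : avg a y (fun r => f r + g r) = avg a y f + avg a y g.
Proof. by rewrite /avg big_split mulrDr. Qed.

Lemma avgZ a y k f : avg a y (fun r => k * f r) = k * avg a y f.
Proof. by rewrite /avg -mulr_sumr mulrCA. Qed.

Lemma avgB a y f g : avg a y (fun r => f r - g r) = avg a y f - avg a y g.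
Proof.
rewrite avgD; congr (_ + _); rewrite -mulN1r -avgZ.
by apply: eq_avg => r _; rewrite mulN1r.
Qed.

Lemma avg_sum a y (I : Type) (s : seq I) f :
  avg a y (fun r => \sum_(i <- s) f i r) = \sum_(i <- s) avg a y (f i).
Proof. by rewrite /avg exchange_big mulr_sumr. Qed.

Lemma avg_const a y k : (0 < a)%N -> y != 0 -> avg a y (fun _ => k) = k.
Proof.
move=> a0 y0; rewrite /avg big_const_seq count_predT size_binom_roots //.
by rewrite iter_addr addr0 -[k *+ a]mulr_natl mulKf // pnatr_eq0 -lt0n.
Qed.

Lemma avg1 y f : y != 0 -> avg 1 y f = f y^-1.
Proof.
move=> y0; rewrite -(@avg_const 1 y (f y^-1)) //; apply: eq_avg => r.
by rewrite expr1 => /(canRL (mulKf y0)); rewrite mulr1 => ->.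
Qed.

(** At a root, the derivative of 1 - y lambda^a is - a / r; the extra r turns the exponent t - 1 of
    the residue into the t of the average. *)
Lemma binom_root_residue a (y : algC) (g : {poly algC}) (r : algC) t :
  (0 < a)%N -> (0 < t)%N -> y * r ^+ a = 1 ->
  r ^+ t.-1 / (binom a y * g)^`().[r] = - (a%:R^-1 * (r ^+ t / g.[r])).
Proof.
move=> a0 t0 yr; have r0 := binom_root_neq0 a0 yr.
rewrite derivM hornerD !hornerM horner_binom yr subrr mul0r addr0 deriv_binom.
rewrite hornerZ hornerXn.
have -> : - (y * a%:R) * r ^+ a.-1 = - a%:R / r.
  apply: (mulIf r0); rewrite divfK // !mulNr -mulrA -exprSr prednK //.
  by rewrite mulrAC yr mul1r.
rewrite -[in RHS](prednK t0) exprS invfM invf_div invrN.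
by ring.
Qed.

Definition coprime_binoms (a1 : nat) (y1 : algC) (a2 : nat) (y2 : algC) :=
  forall r : algC, y1 * r ^+ a1 = 1 -> y2 * r ^+ a2 != 1.

Lemma coprime_binomsC a1 y1 a2 y2 :
  coprime_binoms a1 y1 a2 y2 -> coprime_binoms a2 y2 a1 y1.
Proof. by move=> h r /eqP e; apply: contraL e => /eqP /h. Qed.

(* a3 = 0 is the case of a constant third factor, which has no pole; it occurs
   when (R) reaches c2 = 0. *)
Lemma avg_reciprocity (a1 : nat) (y1 : algC) (a2 : nat) (y2 : algC)
    (a3 : nat) (y3 : algC) (t : nat) :
  (0 < a1)%N -> y1 != 0 -> (0 < a2)%N -> y2 != 0 ->
  (if a3 == 0%N then y3 != 1 else y3 != 0) ->
  coprime_binoms a1 y1 a2 y2 -> coprime_binoms a1 y1 a3 y3 ->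
  coprime_binoms a2 y2 a3 y3 ->
  (0 < t < a1 + a2 + a3)%N ->
  avg a1 y1 (fun r => r ^+ t / ((1 - y2 * r ^+ a2) * (1 - y3 * r ^+ a3))) +
  avg a2 y2 (fun r => r ^+ t / ((1 - y1 * r ^+ a1) * (1 - y3 * r ^+ a3))) +
  avg a3 y3 (fun r => r ^+ t / ((1 - y1 * r ^+ a1) * (1 - y2 * r ^+ a2))) = 0.
Proof.
move=> a1_0 y1_0 a2_0 y2_0 h3 c12 c13 c23 /andP[t0 tlt].
have u3 : uniq (binom_roots a3 y3).
  case: (posnP a3) h3 => [-> /= /binom_roots0 -> //|a3_0].
  exact: binom_roots_uniq.
have s3 : size (binom_roots a3 y3) = a3.
  case: (posnP a3) h3 => [-> /= /binom_roots0 -> //|a3_0].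
  exact: size_binom_roots.
have b3 : binom a3 y3 != 0.
  by case: (posnP a3) h3 => [-> /= /binom0_neq0|/binom_neq0].
have b1 := binom_neq0 y1 a1_0; have b2 := binom_neq0 y2 a2_0.
pose rs := binom_roots a1 y1 ++ binom_roots a2 y2 ++ binom_roots a3 y3.
have urs : uniq rs.
  rewrite !cat_uniq u3 !binom_roots_uniq // !andbT /= has_cat negb_or -!andbA.
  apply/and3P; split; apply/hasPn => r; rewrite !binom_rootsP //.
  - by move/eqP/(coprime_binomsC c12).
  - by move/eqP/(coprime_binomsC c13).
  - by move/eqP/(coprime_binomsC c23).
have szrs : size rs = (a1 + a2 + a3)%N.
  by rewrite !size_cat s3 !size_binom_roots // addnA.
have := @sum_residues _ rs 'X^(t.-1) urs.
rewrite size_polyXn prednK // szrs => /(_ tlt).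
pose k := lead_coef (binom a1 y1) * lead_coef (binom a2 y2) * lead_coef (binom a3 y3).
have k0 : k != 0 by rewrite !mulf_neq0 ?lead_coef_eq0.
have qE : binom a1 y1 * (binom a2 y2 * binom a3 y3) =
          k *: \prod_(s <- rs) ('X - s%:P).
  rewrite !big_cat /= {1}(binomE a1) {1}(binomE a2) {1}(binomE a3) /k.
  rewrite -!scalerAr -!scalerAl ?scalerAr !scalerA.
  by congr (_ * (_ * (_ *: _))); ring.
have resE (s : seq algC) a y g : (0 < a)%N -> s = binom_roots a y ->
    binom a1 y1 * (binom a2 y2 * binom a3 y3) = binom a y * g ->
    k^-1 * \sum_(r <- s) ('X^(t.-1)).[r] / (\prod_(s <- rs) ('X - s%:P))^`().[r] =
    - avg a y (fun r => r ^+ t / g.[r]).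
  move=> a_0 -> bE; rewrite /avg mulr_sumr -mulrN -sumrN mulr_sumr.
  apply: eq_big_seq => r; rewrite binom_rootsP ?binom_neq0 // => /eqP yr.
  rewrite mulrN -(@binom_root_residue a y) // -bE qE derivZ hornerZ !hornerXn.
  by rewrite [in RHS]invfM [RHS]mulrCA.
move/(congr1 (fun x => - (k^-1 * x))); rewrite mulr0 oppr0.
set Q := \prod_(s <- rs) _ in resE *; rewrite big_cat big_cat /= !mulrDr !opprD.
rewrite (resE _ a1 y1 _ a1_0 erefl erefl).
rewrite (resE _ a2 y2 (binom a1 y1 * binom a3 y3) a2_0 erefl); last by ring.
have -> : k^-1 * \sum_(r <- binom_roots a3 y3) ('X^(t.-1)).[r] / Q^`().[r] =
   - avg a3 y3 (fun r => r ^+ t / (binom a1 y1 * binom a2 y2).[r]).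
  case: (posnP a3) h3 => [-> /= y31|a3_0 _].
    by rewrite avg0 binom_roots0 // big_nil mulr0 oppr0.
  by apply: resE => //; ring.
rewrite !opprK => <-; rewrite addrA.
by congr (_ + _ + _); apply: eq_avg => r _; rewrite hornerM !horner_binom.
Qed.

(** As u a + v b = 1, a root is recovered from its a-th power, common to all roots, and its v-th
    power. So r -> r^v maps the a roots for y injectively to the a roots for y^v. *)
Lemma avg_subst (a : nat) (u v b : int) (y : algC) (f : algC -> algC) :
  (0 < a)%N -> y != 0 -> u * a%:Z + v * b = 1 ->
  avg a y (fun r => f (r ^ v)) = avg a (y ^ v) f.
Proof.
move=> a0 y0 uv; congr (_ * _); rewrite -(big_map (fun r => r ^ v) xpredT f).
apply: perm_big.
have yv0 : y ^ v != 0 by rewrite expfz_eq0 negb_and y0 orbT.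
have rootN0 (r : algC) : r \in binom_roots a y -> r != 0.
  by rewrite binom_rootsP ?binom_neq0 // => /eqP /binom_root_neq0 ->.
have inj : {in binom_roots a y &, injective (fun r : algC => r ^ v)}.
  move=> /= r r' hr hr' e.
  have ea : r ^+ a = r' ^+ a.
    move: hr hr'; rewrite !binom_rootsP ?binom_neq0 // => /eqP h /eqP h'.
    by apply: (mulfI y0); rewrite h h'.
  have decomp (x : algC) : x != 0 -> x = (x ^+ a) ^ u * (x ^ v) ^ b.
    by move=> x0; rewrite exprnP !exprz_exp -expfzDr // mulrC uv expr1z.
  by rewrite (decomp r) ?rootN0 // (decomp r') ?rootN0 // ea e.
apply: uniq_perm.
- by rewrite map_inj_in_uniq // binom_roots_uniq.
- exact: binom_roots_uniq.
apply: (uniq_min_size _ _ _).2.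
- by rewrite map_inj_in_uniq // binom_roots_uniq.
- move=> _ /mapP[r hr ->]; move: (hr); rewrite !binom_rootsP ?binom_neq0 // => /eqP h.
  by rewrite exprnP exprz_exp (mulrC v) -exprz_exp -exprnP -expfzMl h exp1rz.
- by rewrite size_map !size_binom_roots.
Qed.

(* The sum of y^i z^j over the solutions (i, j) of a i + b j = m. *)
Definition gen2 (a b : nat) (y z : algC) (m : nat) : algC :=
  \sum_(x < (m %/ a).+1 | (b %| m - a * x)%N) y ^+ x * z ^+ ((m - a * x) %/ b).

Lemma gen2_lt a b y z m : (m < a)%N ->
  gen2 a b y z m = if (b %| m)%N then z ^+ (m %/ b) else 0.
Proof.
move=> ma; rewrite /gen2 divn_small // big_mkcond big_ord_recl big_ord0 /=.
by rewrite muln0 subn0 addr0 expr0 mul1r.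
Qed.

Lemma gen2_rec a b y z m : (0 < a <= m)%N ->
  gen2 a b y z m = (if (b %| m)%N then z ^+ (m %/ b) else 0) + y * gen2 a b y z (m - a).
Proof.
case/andP=> a0 am; rewrite /gen2 big_mkcond big_ord_recl /= muln0 subn0 expr0 mul1r.
congr (_ + _); rewrite -big_mkcond /= big_distrr /=.
have -> : (m %/ a = ((m - a) %/ a).+1)%N.
  by rewrite -[in LHS](subnK am) divnDr ?dvdnn // divnn a0 addn1.
apply: eq_big => [i|i _]; rewrite /bump /= add1n mulnS subnDA //.
by rewrite exprS mulrA.
Qed.

Section TwoFactors.

Variables (a b : nat) (y z : algC).
Hypotheses (a0 : (0 < a)%N) (b0 : (0 < b)%N) (y0 : y != 0) (z0 : z != 0).
Hypothesis cop : coprime_binoms a y b z.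

Let f (m : int) : algC :=
  avg a y (fun r => r ^ m / (1 - z * r ^+ b)) + avg b z (fun r => r ^ m / (1 - y * r ^+ a)).

(** The third factor of [avg_reciprocity] is taken with a3 = 0 and y3 = 0, hence equal to 1. *)
Lemma two_factor_vanish (t : nat) : (0 < t < a + b)%N -> f t = 0.
Proof.
move=> ht; have := @avg_reciprocity a y b z 0 0 t a0 y0 b0 z0.
rewrite eq_sym oner_neq0 addn0 avg0 addr0 => <- //.
- by congr (_ + _); apply: eq_avg => r _; rewrite mul0r subr0 mulr1.
- by move=> r _; rewrite mul0r eq_sym oner_neq0.
- by move=> r _; rewrite mul0r eq_sym oner_neq0.
Qed.

(** Multiplication by 1 - y lambda^a gives zero where this factor is underlined and cancels it where
    it is not. *)
Lemma two_factor_rec (m : int) : f m = avg b z (fun r => r ^ m) + y * f (m + a%:Z).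
Proof.
rewrite /f mulrDr -!avgZ addrCA -avgD; congr (_ + _); apply: eq_avg => r h.
  by rewrite expfzDr ?(binom_root_neq0 _ h) // -exprnP mulrA [y * _]mulrCA h mulr1.
have r0 := binom_root_neq0 b0 h.
have d0 : 1 - y * r ^+ a != 0.
  by rewrite subr_eq0 eq_sym; apply: coprime_binomsC h.
by rewrite expfzDr // -exprnP; field.
Qed.

Lemma avg_expN (n : nat) :
  avg b z (fun r => r ^ (- n%:Z)) = if (b %| n)%N then z ^+ (n %/ b) else 0.
Proof.
case: ifPn => [/dvdnP[k ->]|ndvd].
  rewrite mulnK // -[RHS](avg_const _ b0 z0); apply: eq_avg => r h.
  have -> : (k * b)%N%:Z = b%:Z * k by rewrite PoszM mulrC.
  rewrite -mulrN -exprz_exp -exprnP.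
  by rewrite -[r ^+ b](mulKf z0) h mulr1 exprz_inv opprK.
have [l [t [nE tlt]]] : exists l t : nat, (n + t = l * b)%N /\ (0 < t < b)%N.
  exists (n %/ b).+1, (b - n %% b)%N; move: ndvd; rewrite /dvdn => nd.
  have := ltn_pmod n b0; have := divn_eq n b; lia.
rewrite -[RHS](mulr0 (z ^+ l)).
(* Both t and t + a lie strictly between 0 and a + b, so [f] vanishes at both and the recurrence
   leaves only the average. *)
have <- : avg b z (fun r => r ^ t%:Z) = 0.
  have := two_factor_rec t; rewrite -PoszD !two_factor_vanish; try lia.
  by rewrite mulr0 addr0 => <-.
rewrite -avgZ; apply: eq_avg => r h; have r0 := binom_root_neq0 b0 h.
have -> : - n%:Z = - (b%:Z * l) + t by lia.
rewrite expfzDr // -mulrN -exprz_exp -exprnP.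
by rewrite -[r ^+ b](mulKf z0) h mulr1 exprz_inv opprK.
Qed.

(** The step from -n to -n + a obeys the recurrence of [gen2]; once n < a, the exponent a - n lies
    where [f] vanishes. *)
Lemma two_factor_gen2 (n : nat) : f (- n%:Z) = gen2 a b y z n.
Proof.
elim/ltn_ind: n => n IH; rewrite two_factor_rec avg_expN.
case: (ltnP n a) => na.
  rewrite gen2_lt //; have -> : - n%:Z + a%:Z = (a - n)%N by lia.
  by rewrite two_factor_vanish ?mulr0 ?addr0 //; lia.
rewrite gen2_rec ?a0 //; have -> : - n%:Z + a%:Z = - (n - a)%N%:Z by lia.
by rewrite IH //; lia.
Qed.

End TwoFactors.

(** * The value of F and the step (R) *)

(* The maps h |-> kappa^h, for kappa not a root of unity. *)
Definition exponential (e : rat -> algC) : Prop :=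
  [/\ forall x y, e (x + y) = e x * e y, forall x, e x != 0 &
      forall x, e x = 1 -> x = 0].

Section Exponential.

Variable e : rat -> algC.
Hypothesis he : exponential e.

Lemma expD x y : e (x + y) = e x * e y. Proof. by case: he. Qed.

Lemma exp_neq0 x : e x != 0. Proof. by case: he. Qed.

Lemma exp_eq1 x : e x = 1 -> x = 0. Proof. by case: he => _ _; apply. Qed.

Lemma exp0 : e 0 = 1.
Proof. by apply: (mulfI (exp_neq0 0)); rewrite mulr1 -expD addr0. Qed.

Lemma expN x : e (- x) = (e x)^-1.
Proof. by apply: (mulfI (exp_neq0 x)); rewrite -expD subrr exp0 divff ?exp_neq0. Qed.

Lemma expB x y : e (x - y) = e x / e y. Proof. by rewrite expD expN. Qed.

Lemma expMn x (n : nat) : e (n%:R * x) = e x ^+ n.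
Proof.
elim: n => [|n IH]; first by rewrite mul0r exp0.
by rewrite -natr1 mulrDl mul1r expD IH exprSr.
Qed.

Lemma expMz x (k : int) : e (k%:~R * x) = e x ^ k.
Proof.
case: k => n; first exact: expMn.
by rewrite NegzE rmorphN mulNr expN -exprnN -expMn.
Qed.

Lemma exp_root_pow (a : nat) (al : rat) (r : algC) (k : int) :
  (0 < a)%N -> e al * r ^+ a = 1 -> r ^ (k * a%:Z) = e (- (k%:~R * al)).
Proof.
move=> a0 h; rewrite expN expMz mulrC -exprz_exp -exprnP invr_expz.
by rewrite -[r ^+ a](mulKf (exp_neq0 al)) h mulr1 exprz_inv.
Qed.

(** A common root r gives e al = r^(-a) and e be = r^(-c), so [e] is 1 at a be - c al. *)
Lemma exp_binoms_common (a : nat) (c : int) (al be : rat) (r : algC) :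
  (0 < a)%N -> e al * r ^+ a = 1 -> e be * r ^ c = 1 ->
  a%:R * be - c%:~R * al = 0.
Proof.
move=> a0 ha hc; apply: exp_eq1; rewrite expB expMn expMz.
have r0 := binom_root_neq0 a0 ha.
have -> : e be = r ^ (- c).
  apply: (mulIf (expfz_neq0 c r0)); rewrite hc -expfzDr //.
  by rewrite addrC subrr expr0z.
have -> : e al = r ^ (- a%:Z).
  apply: (mulIf (expfz_neq0 a%:Z r0)); rewrite -exprnP ha exprnP -expfzDr //.
  by rewrite addrC subrr expr0z.
rewrite exprnP !exprz_exp -[_^-1]/((_ ^ _) ^ (-1)) exprz_exp -expfzDr //.
by rewrite [X in r ^ X](_ : _ = 0) ?expr0z //; ring.
Qed.

Lemma exp_coprime_binoms (a c : nat) (al be : rat) :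
  (0 < a)%N -> a%:R * be - c%:R * al != 0 -> coprime_binoms a (e al) c (e be).
Proof.
move=> a0 d r ha; apply: contra_neq d => hc.
exact: (@exp_binoms_common a c _ _ r).
Qed.

End Exponential.

Definition wt (e : rat -> algC) (mu w : 'rV[rat]_3) : algC := e (dot w mu).

(* The expression F at the point where z^w takes the value e <w, mu>. *)
Definition Fval (e : rat -> algC) (mu : 'rV[rat]_3) (f : Fexpr) : algC :=
  avg `|(F_under f).1| (wt e mu (F_under f).2) (fun r =>
    (r ^ (F_num1 f).1 * wt e mu (F_num1 f).2 -
     r ^ (F_num2 f).1 * wt e mu (F_num2 f).2) /
    ((1 - r * wt e mu (F_gamma f)) *
     (1 - r ^ (F_other f).1 * wt e mu (F_other f).2))).

Definition tval (e : rat -> algC) (mu : 'rV[rat]_3) (t : term) : algC :=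
  (wt e mu (t_m1 t) - wt e mu (t_m2 t)) /
  ((1 - wt e mu (t_omega t)) * (1 - wt e mu (t_theta t))).

Definition nondeg (mu : 'rV[rat]_3) (t : term) : bool :=
  (dot (t_omega t) mu != 0) && (dot (t_theta t) mu != 0).

(* Where this is non-zero, the underlined factor and the third factor are
   coprime. *)
Definition Fdet (mu : 'rV[rat]_3) (f : Fexpr) : rat :=
  (F_under f).1%:~R * dot (F_other f).2 mu -
  (F_other f).1%:~R * dot (F_under f).2 mu.

Lemma dotD w w' mu : dot (w + w') mu = dot w mu + dot w' mu.
Proof.
by rewrite -big_split; apply: eq_bigr => i _; rewrite mxE mulrDl.
Qed.

Lemma dotZ k w mu : dot (k *: w) mu = k * dot w mu.
Proof. by rewrite mulr_sumr; apply: eq_bigr => i _; rewrite mxE mulrA. Qed.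

Lemma dotN w mu : dot (- w) mu = - dot w mu.
Proof. by rewrite -scaleN1r dotZ mulN1r. Qed.

Lemma dotB w w' mu : dot (w - w') mu = dot w mu - dot w' mu.
Proof. by rewrite dotD dotN. Qed.

Section StepValue.

Variable e : rat -> algC.
Hypothesis he : exponential e.

(** This is [avg_reciprocity] with exponents a, 1, c, at t1 and at t2. The factor of exponent 1 has
    a single root, which yields the simple term. The bound t <= a of the starred remainder suffices
    even when c = 0. *)
Lemma avg_exchange (a c t1 t2 : nat) (al ga be : rat) (M1 M2 : algC) :
  (0 < a)%N -> (0 < t1 <= a)%N -> (0 < t2 <= a)%N ->
  al - a%:R * ga != 0 -> be - c%:R * ga != 0 -> a%:R * be - c%:R * al != 0 ->
  avg a (e al) (fun r => (r ^+ t1 * M1 - r ^+ t2 * M2) /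
                         ((1 - r * e ga) * (1 - r ^+ c * e be))) =
  (M2 * e (- (t2%:R * ga)) - M1 * e (- (t1%:R * ga))) /
    ((1 - e (al - a%:R * ga)) * (1 - e (be - c%:R * ga))) +
  avg c (e be) (fun r => (r ^+ t2 * M2 - r ^+ t1 * M1) /
                         ((1 - r * e ga) * (1 - r ^+ a * e al))).
Proof.
move=> a0 ht1 ht2 dom dth ddet.
have c12 : coprime_binoms a (e al) 1 (e ga).
  apply: exp_coprime_binoms => //; by rewrite mul1r -oppr_eq0 opprB.
have c13 : coprime_binoms a (e al) c (e be) by apply: exp_coprime_binoms.
have c23 : coprime_binoms 1 (e ga) c (e be).
  by apply: exp_coprime_binoms => //; rewrite mul1r.
(* For c = 0 the hypothesis on theta says be != 0, so the constant third factor is not zero. *)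
have h3 : if c == 0%N then e be != 1 else e be != 0.
  case: eqP => [c0|_]; last exact: exp_neq0.
  by apply: contra_neq dth => /(exp_eq1 he) ->; rewrite c0 mul0r subrr.
have rec t (ht : (0 < t <= a)%N) := @avg_reciprocity a (e al) 1 (e ga) c (e be) t
  a0 (exp_neq0 he _) isT (exp_neq0 he _) h3 c12 c13 c23.
have {}rec t : (0 < t <= a)%N ->
   avg a (e al) (fun r => r ^+ t / ((1 - r * e ga) * (1 - r ^+ c * e be))) =
   - (e (- (t%:R * ga)) / ((1 - e (al - a%:R * ga)) * (1 - e (be - c%:R * ga))) +
   avg c (e be) (fun r => r ^+ t / ((1 - r * e ga) * (1 - r ^+ a * e al)))).
  move=> ht; have /(_ _)/eqP := rec t ht; rewrite -addrA addr_eq0.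
  have -> : (0 < t < a + 1 + c)%N by lia.
  move=> /(_ isT)/eqP h; transitivity
    (avg a (e al) (fun r => r ^+ t / ((1 - e ga * r ^+ 1) * (1 - e be * r ^+ c)))).
    by apply: eq_avg => r _; rewrite expr1 (mulrC r) (mulrC (r ^+ c)).
  rewrite h avg1 ?exp_neq0 //; congr (- (_ + _)).
    by rewrite !exprVn -!expMn // -!expN // -!expD.
  by apply: eq_avg => r _; rewrite expr1 (mulrC r) (mulrC (r ^+ a)) (mulrC (1 - _)).
have lin d y (g : algC -> algC) s1 s2 N1 N2 :
    avg d y (fun r => (r ^+ s1 * N1 - r ^+ s2 * N2) / g r) =
    N1 * avg d y (fun r => r ^+ s1 / g r) - N2 * avg d y (fun r => r ^+ s2 / g r).
  by rewrite -!avgZ -avgB; apply: eq_avg => r _; ring.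
by rewrite !lin !rec //; ring.
Qed.

Lemma exp_root_rem (a : nat) (al x : rat) (r : algC) (l t : int) :
  (0 < a)%N -> e al * r ^+ a = 1 ->
  r ^ (l * a%:Z + t) * e x = r ^ t * e ((- l)%:~R * al + x).
Proof.
move=> a0 h; rewrite expfzDr ?(binom_root_neq0 a0 h) // (exp_root_pow _ _ a0 h) //.
by rewrite expD // rmorphN mulNr; ring.
Qed.

End StepValue.

(** * Cost and value of the recursion *)

(** Runs a program one instruction at a time while an existential variable collects its cost. *)
Lemma bindE (A B : Type) (m : Defs.comp A) (f : A -> Defs.comp B) x k y j :
  m = (Some x, k) -> f x = (Some y, j) -> bind m f = (Some y, (k + j)%N).
Proof. by move=> -> fx; rewrite /bind /= fx. Qed.

Lemma srem_starE (m : int) (d : monomial) :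
  srem_star m d =
  (Some ((sdiv_star m d.1).2, (- (sdiv_star m d.1).1)%:~R *: d.2), 5%N).
Proof. by rewrite /srem_star; case: (sdiv_star m d.1). Qed.

Definition rem_mono (r : int) (d : monomial) (m : 'rV[rat]_3) : monomial :=
  ((div_star r d.1).2, (- (div_star r d.1).1)%:~R *: d.2 + m).

Lemma rem_mulE (r : int) (d : monomial) (m : 'rV[rat]_3) :
  rem_mul r d m = (Some (rem_mono r d m), 8%N).
Proof. by rewrite /rem_mul /rem_star /rem_mono; case: (div_star r d.1). Qed.

Lemma shiftE (m : 'rV[rat]_3) (r : int) (w : 'rV[rat]_3) :
  shift m r w = (Some (m - r%:~R *: w), 6%N).
Proof. by []. Qed.

(** The output of [stepR] without its cost: here (c2, beta2), and in [step_nums] the pair of (t1,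
    m1') and (t2, m2'). *)
Definition step_other (f : Fexpr) : monomial :=
  let d := sdiv_star (F_other f).1 (F_under f).1 in
  let be1 := (- d.1)%:~R *: (F_under f).2 + (F_other f).2 in
  if d.2 < 0 then (- d.2, - be1) else (d.2, be1).

Definition step_nums (f : Fexpr) : monomial * monomial :=
  let: MkF d _ (c, be) (r1, m1) (r2, m2) := f in
  let lc := sdiv_star c d.1 in
  let be1 := (- lc.1)%:~R *: d.2 + be in
  if lc.2 < 0 then (rem_mono (r2 - lc.2) d (m2 - be1), rem_mono (r1 - lc.2) d (m1 - be1))
  else (rem_mono r1 d m1, rem_mono r2 d m2).

Definition step_Fexpr (f : Fexpr) : Fexpr :=
  MkF (step_other f) (F_gamma f) (F_under f) (step_nums f).2 (step_nums f).1.

Definition step_term (f : Fexpr) : term :=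
  let: (c2, be2) := step_other f in
  let: ((t1, m1), (t2, m2)) := step_nums f in
  MkTerm (m2 - t2%:~R *: F_gamma f) (m1 - t1%:~R *: F_gamma f)
    ((F_under f).2 - (F_under f).1%:~R *: F_gamma f)
    (be2 - c2%:~R *: F_gamma f).

(** The count 61 is attained in the branch c1 < 0. *)
Lemma stepRE (f : Fexpr) :
  exists2 k, (k <= 61)%N & stepR f = (Some (step_term f, step_Fexpr f), k).
Proof.
case: f => [[a al] ga [c be] [r1 m1] [r2 m2]].
rewrite /stepR /step_Fexpr /step_term /step_other /step_nums.
rewrite [F_other _]/= [F_under _]/= [F_gamma _]/= [(_, _).1]/= [(_, _).2]/=.
set d := sdiv_star c a; set be1 := _ *: al + be.
case: ifP => d2; (eexists; first last).
- apply: bindE; first exact: srem_starE.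
  do 2!(apply: bindE; first by []).
  apply: bindE.
    rewrite /= -/d d2.
    do 4!(apply: bindE; first by []).
    apply: bindE; first exact: rem_mulE.
    do 2!(apply: bindE; first by []).
    apply: bindE; first exact: rem_mulE.
    by [].
  do 4!(apply: bindE; first exact: shiftE).
  by [].
- by [].
- apply: bindE; first exact: srem_starE.
  do 2!(apply: bindE; first by []).
  apply: bindE.
    rewrite /= -/d d2.
    do 2!(apply: bindE; first exact: rem_mulE).
    by [].
  do 4!(apply: bindE; first exact: shiftE).
  by [].
- by [].
Qed.

(** The pair [k] holds a sign and a quotient: (R) acts on the rows (a, alpha) and (c, beta) by a
    unimodular operation, which is all that determinants and independence need. *)
Lemma step_otherP (f : Fexpr) : 0 < (F_under f).1 ->
  exists2 k : int * int, `|k.1|%N = 1%N &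
    [/\ (step_other f).1 = k.1 * ((F_other f).1 - k.2 * (F_under f).1),
        (step_other f).2 = k.1%:~R *: ((F_other f).2 - k.2%:~R *: (F_under f).2) &
        0 <= (step_other f).1 *+ 2 <= (F_under f).1].
Proof.
move=> a0; have := sdiv_starP (F_other f).1 a0; rewrite /step_other.
case: (sdiv_star _ _) => l c1 /= [cE c1b]; case: ifP => c1s.
  exists (-1, l) => //=; split; last by lia.
    by rewrite cE; ring.
  by rewrite scaleN1r rmorphN scaleNr addrC.
exists (1, l) => //=; split; last by lia.
  by rewrite cE; ring.
by rewrite scale1r rmorphN scaleNr addrC.
Qed.

(** The row operation, the sign s and the exchange of rows multiply [Fdet] by - s. *)
Lemma step_Fdet (mu : 'rV[rat]_3) (f : Fexpr) : 0 < (F_under f).1 ->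
  Fdet mu (step_Fexpr f) != 0 -> Fdet mu f != 0.
Proof.
case/step_otherP => -[s l] /= s1 [E1 E2 _]; apply: contra_neq.
rewrite /Fdet /= E1 E2 dotZ dotB dotZ => h.
transitivity (- s%:~R * ((F_under f).1%:~R * dot (F_other f).2 mu -
  (F_other f).1%:~R * dot (F_under f).2 mu)); last by rewrite h mulr0.
by ring.
Qed.

Lemma rem_monoP (r : int) (a : nat) (al m : 'rV[rat]_3) : (0 < a)%N ->
  exists l (t : nat), [/\ rem_mono r (Posz a, al) m = (Posz t, (- l)%:~R *: al + m),
    r = l * a%:Z + t & (0 < t <= a)%N].
Proof.
move=> a0; exists ((r - 1) %/ a)%Z, `|(r - ((r - 1) %/ a)%Z * a)%R|%N.
split; [|lia|lia].
by rewrite /rem_mono /div_star; congr (_, _); rewrite /=; lia.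
Qed.

Lemma step_value (e : rat -> algC) (mu : 'rV[rat]_3) (f : Fexpr) :
  exponential e -> 0 < (F_under f).1 -> nondeg mu (step_term f) ->
  Fdet mu (step_Fexpr f) != 0 ->
  Fval e mu f = tval e mu (step_term f) + Fval e mu (step_Fexpr f).
Proof.
move=> he a0; have [_ _ [_ _ c2b]] := step_otherP a0; move: a0 c2b.
case: f => [[a al] ga [c be] [r1 m1] [r2 m2]] /=; case: a => // a a0 c2b.
set f := MkF _ _ _ _ _ in c2b *.
(* At a root of the underlined factor, numerators and third factor may be replaced by their
   remainders; [red] records this for their quotient. *)
have [c2 [be2 [t1 [m1' [t2 [m2' [[oE nE] ht1 ht2 red]]]]]]] :
  exists (c2 : nat) be2 (t1 : nat) m1' (t2 : nat) m2',
  [/\ step_other f = (Posz c2, be2) /\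
        step_nums f = ((Posz t1, m1'), (Posz t2, m2')),
      (0 < t1 <= a)%N, (0 < t2 <= a)%N &
      forall r, wt e mu al * r ^+ a = 1 ->
      (r ^ r1 * wt e mu m1 - r ^ r2 * wt e mu m2) / (1 - r ^ c * wt e mu be) =
      (r ^+ t1 * wt e mu m1' - r ^+ t2 * wt e mu m2') / (1 - r ^+ c2 * wt e mu be2)].
  move: c2b; rewrite /step_other /step_nums /=.
  have := sdiv_starP c a0; case: (sdiv_star c a) => l [c1|c1] [cE c1b] c2b /=.
  - have [l1 [t1 [r1D r1E t1b]]] := rem_monoP r1 al m1 a0.
    have [l2 [t2 [r2D r2E t2b]]] := rem_monoP r2 al m2 a0.
    exists c1, ((- l)%:~R *: al + be), t1, ((- l1)%:~R *: al + m1), t2.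
    exists ((- l2)%:~R *: al + m2).
    rewrite r1D r2D; split=> // {r1D r2D}.
    move=> r h; rewrite /wt in h *; rewrite !dotD !dotZ cE r1E r2E.
    by rewrite !(exp_root_rem he _ _ _ a0 h) -!exprnP.
  (* The signed remainder is the negative [Negz c1]. Multiplying numerator and denominator by minus
     the inverse of its monomial inverts the monomial of the third factor and exchanges the two
     numerators. *)
  - pose be1 := (- l)%:~R *: al + be.
    have [l2 [t1 [r2D r2E t1b]]] := rem_monoP (r2 - Negz c1) al (m2 - be1) a0.
    have [l1 [t2 [r1D r1E t2b]]] := rem_monoP (r1 - Negz c1) al (m1 - be1) a0.
    exists c1.+1, (- be1), t1, ((- l2)%:~R *: al + (m2 - be1)), t2.
    exists ((- l1)%:~R *: al + (m1 - be1)).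
    rewrite r1D r2D; split=> // {r1D r2D}.
    move=> r h; rewrite /wt in h *.
    have r0 := binom_root_neq0 a0 h.
    set R := r ^+ c1.+1; have R0 : R != 0 by rewrite expf_neq0.
    have rN (x : int) y l' (t' : nat) : x - Negz c1 = l' * a%:Z + t' ->
        r ^ x * e y = r ^+ t' * e ((- l')%:~R * dot al mu + y) / R.
      move=> xE; have -> : x = l' * a%:Z + t' + Negz c1 by rewrite -xE subrK.
      rewrite expfzDr // [LHS]mulrAC; congr (_ / _).
      exact: exp_root_rem.
    rewrite (rN _ _ _ _ r1E) (rN _ _ _ _ r2E) (rN c _ l 0%N); last first.
      by rewrite cE addrK addr0.
    rewrite !(dotD, dotN, dotZ).
    set P := (- l)%:~R * dot al mu + _; rewrite !addrA !(expB he) (expN he) expr0 mul1r.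
    have P0 := exp_neq0 he P.
    (* If the third factor vanishes at r, both quotients are 0 by the convention 0^-1 = 0. *)
    case: (eqVneq (e P) R) => [->|PR].
      by rewrite divff // subrr invr0 !mulr0.
    by field; rewrite P0 R0 !subr_eq0 PR eq_sym PR.
rewrite /nondeg /Fdet /Fval /tval /step_Fexpr /step_term oE nE /= /wt.
rewrite !(dotB, dotZ) => /andP[dom dth] ddet.
transitivity (avg a (e (dot al mu)) (fun r =>
    (r ^+ t1 * e (dot m1' mu) - r ^+ t2 * e (dot m2' mu)) /
    ((1 - r * e (dot ga mu)) * (1 - r ^+ c2 * e (dot be2 mu))))).
  apply: eq_avg => r /red; rewrite /wt => h.
  by rewrite [in LHS]invfM mulrCA h [in RHS]invfM [RHS]mulrCA.
rewrite (avg_exchange he _ _ a0 ht1 ht2 dom dth); last first.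
  by rewrite -oppr_eq0 opprB.
by rewrite -!(expD he).
Qed.

Lemma step_under_half (f : Fexpr) (a : nat) : (F_under f).1 = Posz a -> (0 < a)%N ->
  exists2 c2 : nat, (F_under (step_Fexpr f)).1 = Posz c2 & (c2.*2 <= a)%N.
Proof.
move=> aE a0; have [|_ _ [_ _]] := @step_otherP f; first by rewrite aE.
rewrite aE /=; case: (step_other f).1 => c2 /= h; last by lia.
by exists c2 => //; lia.
Qed.

(** Exponent of the underlined factor at lambda = z^(-gamma). It is the omega of the term split off
    by (R), whose theta is [Fomega] of the next expression. *)
Definition Fomega (f : Fexpr) : 'rV[rat]_3 :=
  (F_under f).2 - (F_under f).1%:~R *: F_gamma f.

Definition Ftheta (f : Fexpr) : 'rV[rat]_3 :=
  (F_other f).2 - (F_other f).1%:~R *: F_gamma f.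

Definition F_indep (f : Fexpr) : Prop :=
  forall x y : rat, x *: Fomega f + y *: Ftheta f = 0 -> x = 0 /\ y = 0.

Definition regular_term (t : term) : bool := (t_omega t != 0) && (t_theta t != 0).

(** Independence survives the unimodular operation; the term's omega and theta are [Ftheta] and
    [Fomega] of the new expression, hence non-zero. *)
Lemma step_indep (f : Fexpr) : 0 < (F_under f).1 -> F_indep f ->
  F_indep (step_Fexpr f) /\ regular_term (step_term f).
Proof.
move=> a0 ind; have [[s l] /= s1 [E1 E2 _]] := step_otherP a0.
have ss : s%:~R * s%:~R = 1 :> rat.
  by rewrite -intrM; have -> : s * s = 1 by lia.
have ind' : F_indep (step_Fexpr f).
  move=> x y; rewrite /Fomega /Ftheta /= E1 E2 => h.
  have [|h1 h2] := ind (y - x * s%:~R * l%:~R) (x * s%:~R).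
    by rewrite -[RHS]h; apply/rowP => i; rewrite !mxE; ring.
  have x0 : x = 0 by rewrite -[x]mulr1 -ss mulrA h2 mul0r.
  by move: h1; rewrite x0 !mul0r subr0.
split=> //; move: (ind' 1 0) (ind' 0 1).
rewrite /regular_term /step_term /Fomega /Ftheta /=; case: (step_other f) => c2 be2.
case: (step_nums f) => [[t1 m1'] [t2 m2']] /=.
rewrite !scale1r !scale0r addr0 add0r => i1 i2.
apply/andP; split; apply/eqP => h; [have [_] := i2 h|have [+ _] := i1 h];
  by move/eqP; rewrite oner_eq0.
Qed.

(** For a = 1 the only root is z^(-alpha). The omega of the term is minus [Fomega], and its theta is
    [Ftheta] - c [Fomega], whose product with mu is [Fdet]. *)
Lemma base1E (f : Fexpr) : exists2 t, base1 f = (Some t, 21%N) & (F_under f).1 = 1 ->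
  [/\ forall e mu, exponential e -> Fval e mu f = tval e mu t,
      forall mu, nondeg mu t -> Fdet mu f != 0 /\ dot (Fomega f) mu != 0 &
      F_indep f -> regular_term t].
Proof.
case: f => [[a al] ga [c be] [r1 m1] [r2 m2]].
exists (MkTerm (m1 - r1%:~R *: al) (m2 - r2%:~R *: al) (ga - al) (be - c%:~R *: al)).
  by [].
move=> /= ->; split.
- move=> e mu he; rewrite /Fval /tval /= avg1 ?exp_neq0 //.
  rewrite /wt !(dotB, dotZ) !(expB he) !(expMz he) !exprz_inv.
  by rewrite -!invr_expz ![_^-1 * _]mulrC.
- move=> mu /andP[/= om th]; rewrite /Fdet /Fomega /= mul1r scale1r.
  by split; [rewrite -dotZ -dotB|rewrite -oppr_eq0 -dotN opprB].
- move=> ind; rewrite /regular_term /=; apply/andP; split; apply/eqP => h.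
    have [] := ind 1 0; last by move/eqP; rewrite oner_eq0.
    by rewrite /Fomega /= scale1r !scale0r addr0 scale1r -opprB h oppr0.
  have [] := ind (- c%:~R) 1; last by move=> _ /eqP; rewrite oner_eq0.
  by rewrite /Fomega /Ftheta /= -[RHS]h; apply/rowP => i; rewrite !mxE; ring.
Qed.

Lemma iterR_under0 (k : nat) (f : Fexpr) :
  (F_under f).1 = 0 -> iterR k f = (Some [::], 1%N).
Proof. by case: k => [|k] /= ->. Qed.

Lemma iterR_under1 (k : nat) (f : Fexpr) (t : term) (j : nat) :
  (F_under f).1 = 1 -> base1 f = (Some t, j) -> iterR k f = (Some [:: t], j.+2).
Proof.
by case: k => [|k] /= -> E; rewrite /bind /= E /= addn0.
Qed.

Lemma iterR_step (k : nat) (f f' : Fexpr) (t : term) (ts : seq term) (j j' : nat) :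
  (F_under f).1 != 0 -> (F_under f).1 != 1 -> stepR f = (Some (t, f'), j) ->
  iterR k f' = (Some ts, j') -> iterR k.+1 f = (Some (t :: ts), (j + j').+2).
Proof.
by move=> /negbTE a0 /negbTE a1 E E'; rewrite /= a0 /bind /= a1 /= E /= E' addn0.
Qed.

(** The second clause recovers coprimality from the final terms alone: [Fdet] serves the preceding
    step (R), and [Fomega] serves the first two factors of the initial expression. *)
Definition expansion (f : Fexpr) (ts : seq term) : Prop :=
  [/\ F_indep f -> all regular_term ts,
    forall mu, all (nondeg mu) ts -> Fdet mu f != 0 /\ dot (Fomega f) mu != 0 &
    forall e mu, exponential e -> all (nondeg mu) ts ->
      Fval e mu f = \sum_(t <- ts) tval e mu t].

Lemma iterR_base (k : nat) (f : Fexpr) : (F_under f).1 = 1 ->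
  exists ts j, [/\ iterR k f = (Some ts, j), (size ts <= k.+1)%N,
    (j <= 23 + 63 * k)%N & expansion f ts].
Proof.
move=> f1; have [t tE /(_ f1)[tv td tr]] := base1E f.
exists [:: t], 23%N; split; [exact: iterR_under1 tE|by []|exact: leq_addr|split].
- by rewrite /= andbT.
- by move=> mu /= /andP[/td].
- by move=> e mu he _; rewrite big_seq1 tv.
Qed.

(** Each step at least halves the underlined exponent. A step costs at most 61 plus two tests, the
    base case 21 plus two tests. *)
Lemma iterRP (k : nat) (f : Fexpr) (a : nat) :
  (F_under f).1 = Posz a -> (0 < a < 2 ^ k.+1)%N ->
  exists ts j, [/\ iterR k f = (Some ts, j), (size ts <= k.+1)%N,
    (j <= 23 + 63 * k)%N & expansion f ts].
Proof.
elim: k f a => [|k IH] f a aE /andP[a0 ak].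
  by apply: iterR_base; rewrite aE; congr Posz; lia.
case: (eqVneq a 1%N) => [a1|a1]; first by apply: iterR_base; rewrite aE a1.
have [j jle sE] := stepRE f.
have [c2 c2E c2h] := step_under_half aE a0.
have fa0 : 0 < (F_under f).1 by rewrite aE.
(* If c2 = 0, the remaining list is empty and says nothing about mu; the determinant is then - a
   <beta2, mu>, and beta2 is the theta of the current term. *)
have [ts [j' [E [sz j'le] [reg det val]]]] :
  exists ts j, [/\ iterR k (step_Fexpr f) = (Some ts, j),
    (size ts <= k.+1)%N /\ (j <= 23 + 63 * k)%N &
    [/\ F_indep (step_Fexpr f) -> all regular_term ts,
      forall mu, nondeg mu (step_term f) -> all (nondeg mu) ts ->
        Fdet mu (step_Fexpr f) != 0 &
      forall e mu, exponential e -> all (nondeg mu) ts ->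
        Fval e mu (step_Fexpr f) = \sum_(t <- ts) tval e mu t]].
  case: (posnP c2) c2E => [->|c20] c2E; last first.
    have [|ts [j' [E sz j'le [reg det val]]]] := IH _ _ c2E.
      by move: ak; rewrite !expnS; lia.
    by exists ts, j'; split=> //; split=> // mu _ /det[].
  exists [::], 1%N; split; [exact: iterR_under0|by []|split=> //].
  - move=> mu; rewrite /nondeg /step_term /Fdet /=; move: c2E => /=.
    case: (step_other f) => c2' be2; case: (step_nums f) => [[t1 m1'] [t2 m2']] /= ->.
    rewrite scale0r subr0 mul0r sub0r oppr_eq0 => /andP[_ be0] _.
    by rewrite mulf_neq0 // aE pnatr_eq0 -lt0n.
  - by move=> e mu _ _; rewrite /Fval c2E avg0 big_nil.
exists (step_term f :: ts), (j + j').+2; split.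
- by apply: iterR_step sE E; rewrite aE; lia.
- by rewrite /= ltnS.
- by lia.
split; first by move=> /(step_indep fa0)[/reg + ?] /= => ->; rewrite andbT.
- move=> mu /= /andP[nd /(det _ nd)] d; split; first exact: step_Fdet d.
  move: nd; rewrite /nondeg /step_term.
  by case: (step_other f) => ? ?; case: (step_nums f) => [[? ?] [? ?]] /andP[].
- move=> e mu he /= /andP[nd nds]; rewrite big_cons -val //.
  by apply: step_value => //; apply: det.
Qed.

(** * The sum T(a) + T(b) *)

Section ReducedTerms.

Variable e : rat -> algC.
Hypothesis he : exponential e.

(** This is [avg_subst], together with r^(b v) = r z1^(u / v) at the roots, which follows from b v =
    1 - a u. It serves T(b) as well, with a, b and u, v exchanged. *)
Lemma avg_multiplier (a b c : nat) (u v n s E : int) (m1 m2 m3 : rat) :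
  (0 < a)%N -> v != 0 -> u * a%:Z + v * b%:Z = 1 ->
  avg a (e (v%:~R^-1 * m1)) (fun r =>
    (r ^ (- (n * v)) - r ^ (E * v) * e (s%:~R * m3)) /
    ((1 - r * e (u%:~R / v%:~R * m1 + m2)) * (1 - r ^ (c%:Z * v) * e m3))) =
  avg a (e m1) (fun r =>
    (r ^ (- n) - r ^ E * e m3 ^ s) / ((1 - r ^+ b * e m2) * (1 - r ^+ c * e m3))).
Proof.
move=> a0 v0 uv; have vQ : v%:~R != 0 :> rat by rewrite intr_eq0.
rewrite -[m1 in RHS](mulVKf vQ) [in RHS](expMz he) -(avg_subst _ a0 (exp_neq0 he _) uv).
apply: eq_avg => r h; have r0 := binom_root_neq0 a0 h.
rewrite !exprnP !exprz_exp (expMz he) -mulrN ![_ * v]mulrC.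
have -> : r ^ (v * b) = r * e (u%:~R / v%:~R * m1).
  have -> : v * b = 1 + (- u) * a%:Z by rewrite -uv; ring.
  rewrite expfzDr // expr1z (exp_root_pow he _ a0 h); congr (r * e _).
  by rewrite rmorphN mulNr opprK mulrA.
by rewrite (expD he) (mulrA r) !mulrN (mulrC v n).
Qed.

(** The numerator is lambda^(-n) (1 - (lambda^c z3)^s), so the third factor, non-zero at the roots,
    divides out to a geometric sum; its k-th term is the two-factor problem for n - k c. *)
Lemma avg_truncated (a b c : nat) (n : int) (s : nat) (m1 m2 m3 : rat) :
  (0 < a)%N -> (0 < b)%N ->
  a%:R * m2 - b%:R * m1 != 0 -> a%:R * m3 - c%:R * m1 != 0 ->
  b%:R * m3 - c%:R * m2 != 0 ->
  (forall k, (k < s)%N -> (k * c)%N%:Z <= n) ->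
  avg a (e m1) (fun r => (r ^ (- n) - r ^ ((s * c)%N%:Z - n) * e m3 ^ s) /
    ((1 - r ^+ b * e m2) * (1 - r ^+ c * e m3))) +
  avg b (e m2) (fun r => (r ^ (- n) - r ^ ((s * c)%N%:Z - n) * e m3 ^ s) /
    ((1 - r ^+ a * e m1) * (1 - r ^+ c * e m3))) =
  \sum_(k < s) e m3 ^+ k * gen2 a b (e m1) (e m2) `|n - (k * c)%N%:Z|.
Proof.
move=> a0 b0 d12 d13 d23 kn.
have geom d x (g : algC -> algC) : (0 < d)%N -> d%:R * m3 - c%:R * x != 0 ->
   avg d (e x) (fun r => (r ^ (- n) - r ^ ((s * c)%N%:Z - n) * e m3 ^ s) /
    ((1 - g r) * (1 - r ^+ c * e m3))) =
   \sum_(k < s) e m3 ^+ k * avg d (e x) (fun r =>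
      r ^ (- `|n - (k * c)%N%:Z|%:Z) / (1 - g r)).
  move=> d0 dx; under eq_bigr do rewrite -avgZ.
  rewrite -(avg_sum _ _ (index_enum 'I_s)
    (fun k r => e m3 ^+ k * (r ^ (- `|n - (k * c)%N%:Z|%:Z) / (1 - g r)))).
  apply: eq_avg => r h; have r0 := binom_root_neq0 d0 h.
  have W1 : 1 - r ^+ c * e m3 != 0.
    rewrite subr_eq0 eq_sym mulrC; exact: (exp_coprime_binoms he d0 dx).
  have -> : r ^ (- n) - r ^ ((s * c)%N%:Z - n) * e m3 ^ s =
      r ^ (- n) * (1 - (r ^+ c * e m3) ^+ s).
    rewrite mulrBr mulr1 exprMn -exprM mulrA expfzDr // mulnC.
    by congr (_ - _ * _); rewrite mulrC.
  have -> : 1 - (r ^+ c * e m3) ^+ s =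
      (1 - r ^+ c * e m3) * \sum_(k < s) (r ^+ c * e m3) ^+ k.
    by rewrite -opprB subrX1 -mulNr opprB.
  rewrite mulrCA [(1 - g r) * _]mulrC -mulf_div divff // mul1r mulr_sumr mulr_suml.
  apply: eq_bigr => k _; have kc := kn k (ltn_ord k).
  have -> : - `|n - (k * c)%N%:Z|%:Z = (k * c)%N%:Z - n by lia.
  by rewrite expfzDr // exprMn -exprM mulnC -exprnP; ring.
rewrite !geom // -big_split; apply: eq_bigr => k _ /=; rewrite -mulrDr.
congr (_ * _); rewrite -two_factor_gen2 ?exp_neq0 //.
  by congr (_ + _); apply: eq_avg => r _; rewrite (mulrC (r ^+ _)).
exact: exp_coprime_binoms.
Qed.

End ReducedTerms.

(** * Constant terms at kappa = 1 *)

(* The positive real number k^h, for k > 0. *)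
Definition ratpow (k : nat) (h : rat) : algC :=
  `|denq h|%N.-root k%:R ^ numq h.

Lemma ratpow_gt0 k h : (0 < k)%N -> 0 < ratpow k h.
Proof. by move=> k0; rewrite exprz_gt0 // rootC_gt0 ?ltr0n // absz_gt0 denq_neq0. Qed.

Lemma absz_denq_mul (h : rat) : `|denq h|%N%:R * h = (numq h)%:~R.
Proof. by rewrite numqE mulrC -{2}absz_denq. Qed.

(** The fraction p / q need not be reduced: both sides are positive, so their powers of exponent
    [denq h] can be compared. *)
Lemma ratpow_frac (k : nat) (p : int) (q : nat) (h : rat) :
  (0 < k)%N -> (0 < q)%N -> q%:R * h = p%:~R -> ratpow k h ^+ q = k%:R ^ p.
Proof.
move=> k0 q0 hE; have d0 : (0 < `|denq h|)%N by rewrite absz_gt0 denq_neq0.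
have x0 := ratpow_gt0 h k0.
have kp : 0 < k%:R ^ p :> algC by rewrite exprz_gt0 ?ltr0n.
apply/eqP; rewrite -(@eqrXn2 _ `|denq h|%N) ?(ltW kp) ?exprn_ge0 ?(ltW x0) //.
rewrite /ratpow !exprnP !exprz_exp.
have -> : numq h * (q%:Z * `|denq h|%N%:Z) = `|denq h|%N%:Z * (p * `|denq h|%N%:Z).
  rewrite mulrA mulrC; congr (_ * _); apply: (@intr_inj rat).
  by rewrite !intrM numqE -hE absz_denq; ring.
by rewrite -exprz_exp -exprnP rootCK.
Qed.

Lemma ratpow_int (k : nat) (p : int) (h : rat) :
  (0 < k)%N -> h = p%:~R -> ratpow k h = k%:R ^ p.
Proof. by move=> k0 hE; rewrite -[LHS]expr1 (@ratpow_frac _ p) // mul1r. Qed.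

(** Additivity is checked on (dx dy)-th powers of positive numbers. The scale N serves later to make
    finitely many exponents integral. *)
Lemma ratpow_exponential (k N : nat) : (1 < k)%N -> (0 < N)%N ->
  exponential (fun h => ratpow k (N%:R * h)).
Proof.
move=> k1 N0; have k0 : (0 < k)%N by exact: ltnW.
have pos h := ratpow_gt0 h k0.
split=> [x y|x|x]; last 2 first.
- by rewrite gt_eqF.
- set h := N%:R * x => h1.
  have d0 : (0 < `|denq h|)%N by rewrite absz_gt0 denq_neq0.
  have : k%:R ^ numq h = 1 :> algC.
    by rewrite -(@ratpow_frac k _ `|denq h|%N h) ?h1 ?expr1n // absz_denq_mul.
  move/eqP; rewrite pexprz_eq1 // pnatr_eq1 (gtn_eqF k1) orbF.
  rewrite numq_eq0 /h mulf_eq0 pnatr_eq0 => /orP[/eqP N00|/eqP//].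
  by rewrite N00 in N0.
rewrite mulrDr; move: (N%:R * x) (N%:R * y) => {}x {}y.
pose dx := `|denq x|%N; pose dy := `|denq y|%N.
have dx0 : (0 < dx)%N by rewrite absz_gt0 denq_neq0.
have dy0 : (0 < dy)%N by rewrite absz_gt0 denq_neq0.
apply/eqP; rewrite -(@eqrXn2 _ (dx * dy)%N) ?muln_gt0 ?dx0 ?mulr_ge0 ?(ltW (pos _)) //.
apply/eqP; have hx : dx%:R * x = (numq x)%:~R := absz_denq_mul x.
have hy : dy%:R * y = (numq y)%:~R := absz_denq_mul y.
rewrite (@ratpow_frac _ (numq x * dy%:Z + numq y * dx%:Z)) ?muln_gt0 ?dx0 //; last first.
  by rewrite intrD !intrM -hx -hy natrM; ring.
rewrite exprMn exprM (@ratpow_frac _ (numq x)) // mulnC exprM (@ratpow_frac _ (numq y)) //.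
by rewrite expfzDr ?pnatr_eq0 -?lt0n // -!exprz_exp.
Qed.

Lemma common_denominator (s : seq rat) :
  exists2 N : nat, (0 < N)%N & all (fun x => N%:R * x \is a Num.int) s.
Proof.
elim: s => [|y s [N N0 IH]]; first by exists 1%N.
exists (N * `|denq y|)%N; first by rewrite muln_gt0 N0 absz_gt0 denq_neq0.
apply/andP; split; first by rewrite natrM -mulrA absz_denq_mul rpredM ?rpred_nat ?intr_int.
by apply: sub_all IH => x h; rewrite natrM mulrAC rpredM ?rpred_nat.
Qed.

(* f agrees at every k > 1 with a rational function that equals
   p + q (kappa - 1) + ... near kappa = 1. *)
Definition jet (f : nat -> algC) (p q : algC) : Prop :=
  exists A B : {poly algC}, [/\ B.[1] != 0,
    forall k, (1 < k)%N -> f k * B.[k%:R] = A.[k%:R],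
    A.[1] = p * B.[1] & A^`().[1] = p * B^`().[1] + q * B.[1]].

Lemma poly_neq0_nat (K : numFieldType) (P : {poly K}) : P != 0 ->
  exists2 k, (1 < k)%N & P.[k%:R] != 0.
Proof.
move=> P0; pose s := [seq k.+2 | k <- iota 0 (size P)].
have [/hasP[_ /mapP[k _ ->] Pk]|/hasPn rts] := boolP (has (fun k => P.[k%:R] != 0) s).
  by exists k.+2.
case/eqP: P0; apply: (@roots_geq_poly_eq0 _ _ [seq k%:R | k <- s]).
- by apply/allP => _ /mapP[k /rts + ->]; rewrite negbK.
- rewrite !map_inj_uniq ?iota_uniq // => [i j []//|i j /eqP].
  by rewrite eqr_nat => /eqP.
- by rewrite !size_map size_iota.
Qed.

(** The cross products A B' and A' B agree at all integers above 1, hence as polynomials; their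
    values and derivatives at 1 are compared. *)
Lemma jet_unique f p q p' q' : jet f p q -> jet f p' q' -> p = p' /\ q = q'.
Proof.
move=> [A [B [B0 fB A1 dA1]]] [A' [B' [B'0 fB' A'1 dA'1]]].
have E : A * B' = A' * B.
  apply/eqP; rewrite -subr_eq0; apply: contraT => /poly_neq0_nat[k k1] /eqP[].
  by rewrite !(hornerD, hornerN, hornerM) -fB // -fB' //; ring.
have pp : p = p'.
  have := congr1 (fun P : {poly algC} => P.[1]) E.
  rewrite !hornerM A1 A'1 -mulrA (mulrC B.[1]) mulrA -mulrA.
  by rewrite -mulrA; move/(mulIf (mulf_neq0 B'0 B0)).
split=> //; have := congr1 (fun P : {poly algC} => P^`().[1]) E.
rewrite !derivM !hornerD !hornerM A1 A'1 dA1 dA'1 -pp => h.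
apply: (mulIf (mulf_neq0 B0 B'0)); apply/eqP; rewrite -subr_eq0; apply/eqP.
by move/eqP: h; rewrite -subr_eq0 => /eqP <-; ring.
Qed.

Lemma eq_jet f g p q : (forall k, (1 < k)%N -> f k = g k) -> jet f p q -> jet g p q.
Proof.
by move=> fg [A [B [B0 fB A1 dA1]]]; exists A, B; split=> // k k1; rewrite -fg // fB.
Qed.

Lemma jetD f g p q p' q' :
  jet f p q -> jet g p' q' -> jet (fun k => f k + g k) (p + p') (q + q').
Proof.
move=> [A [B [B0 fB A1 dA1]]] [A' [B' [B'0 fB' A'1 dA'1]]].
exists (A * B' + A' * B), (B * B'); split.
- by rewrite hornerM mulf_neq0.
- by move=> k k1; rewrite !(hornerD, hornerN, hornerM) -fB // -fB' //; ring.
- by rewrite !(hornerD, hornerN, hornerM) A1 A'1; ring.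
- by rewrite !(derivD, derivM) !(hornerD, hornerN, hornerM) A1 A'1 dA1 dA'1; ring.
Qed.

Lemma jetM f g p q p' q' :
  jet f p q -> jet g p' q' -> jet (fun k => f k * g k) (p * p') (p * q' + q * p').
Proof.
move=> [A [B [B0 fB A1 dA1]]] [A' [B' [B'0 fB' A'1 dA'1]]].
exists (A * A'), (B * B'); split.
- by rewrite hornerM mulf_neq0.
- by move=> k k1; rewrite !(hornerD, hornerN, hornerM) -fB // -fB' //; ring.
- by rewrite !(hornerD, hornerN, hornerM) A1 A'1; ring.
- by rewrite !(derivD, derivM) !(hornerD, hornerN, hornerM) A1 A'1 dA1 dA'1; ring.
Qed.

Lemma jetV f p q : (forall k, (1 < k)%N -> f k != 0) -> p != 0 -> jet f p q ->
  jet (fun k => (f k)^-1) p^-1 (- q / p ^+ 2).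
Proof.
move=> f0 p0 [A [B [B0 fB A1 dA1]]]; exists B, A; split.
- by rewrite A1 mulf_neq0.
- by move=> k k1; rewrite -fB // mulKf // f0.
- by rewrite A1 mulKf.
- by rewrite dA1 A1; field.
Qed.

Lemma jet_cst (x : algC) : jet (fun _ => x) x 0.
Proof.
exists x%:P, 1%:P; rewrite !derivC !hornerC; split=> //.
- exact: oner_neq0.
- by move=> k _; rewrite !hornerC mulr1.
- by rewrite mulr1.
- by rewrite !mul0r mulr0 addr0.
Qed.

Lemma jet_exprz (h : int) : jet (fun k => k%:R ^ h) 1 h%:~R.
Proof.
case: h => n.
  exists ('X^n), 1%:P; rewrite derivXn derivC !hornerC; split=> //.
  - exact: oner_neq0.
  - by move=> k _; rewrite hornerC mulr1 hornerXn.
  - by rewrite hornerXn expr1n mulr1.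
  - by rewrite hornerMn hornerXn expr1n mulr0 add0r mulr1.
exists 1%:P, ('X^(n.+1)); rewrite derivXn derivC !hornerC; split=> //.
- by rewrite hornerXn expr1n oner_neq0.
- move=> k k1; rewrite hornerC hornerXn /= mulVf // expf_neq0 // pnatr_eq0.
  by rewrite -lt0n ltnW.
- by rewrite hornerXn expr1n mulr1.
- by rewrite hornerMn !hornerXn !expr1n NegzE rmorphN mul1r mulr1 subrr.
Qed.

Lemma natr_gt1_neq0 (k : nat) : (1 < k)%N -> 1 - k%:R != 0 :> algC.
Proof. by move=> k1; rewrite subr_eq0 eq_sym pnatr_eq1 gtn_eqF. Qed.

(** For h >= 0 this is the jet of 1 + kappa + ... + kappa^(h-1); negative h reduces to it by 1 -
    kappa^h = - kappa^h (1 - kappa^(-h)). *)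
Lemma jet_quotient (h : int) :
  jet (fun k => (1 - k%:R ^ h) / (1 - k%:R)) h%:~R (h%:~R * (h%:~R - 1) / 2).
Proof.
have pos (n : nat) :
    jet (fun k => (1 - k%:R ^+ n) / (1 - k%:R)) n%:R (n%:R * (n%:R - 1) / 2).
  elim: n => [|n IH].
    rewrite !mul0r; apply: eq_jet (jet_cst 0) => k _.
    by rewrite expr0 subrr mul0r.
  have := jetD IH (jet_exprz n).
  have -> : n%:R * (n%:R - 1) / 2 + n%:~R = n.+1%:R * (n.+1%:R - 1) / 2 :> algC.
    by rewrite -natr1; field.
  rewrite natr1; apply: eq_jet => k /natr_gt1_neq0 k1.
  by rewrite exprS -exprnP; field.
case: h => n; first exact: pos.
have := jetM (jet_cst (-1)) (jetM (jet_exprz (Negz n)) (pos n.+1)).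
rewrite NegzE rmorphN /=.
have -> : -1 * (1 * n.+1%:R) = - n.+1%:~R :> algC by rewrite mul1r mulN1r.
rewrite (_ : _ + 0 * _ = - n.+1%:~R * (- n.+1%:~R - 1) / 2); last first.
  by rewrite -!pmulrn; move: (n.+1%:R) => x; field.
apply: eq_jet => k k1; have n0 : k%:R ^+ n.+1 != 0 :> algC.
  by rewrite expf_neq0 // pnatr_eq0 -lt0n ltnW.
by rewrite -exprnN; field; rewrite n0 natr_gt1_neq0.
Qed.

(* [ct f x]: if f (kappa) is a rational function of kappa with at most a simple
   pole at 1, then x is the constant term in t of f (e^t).  With kappa = e^t,
   (1 - kappa) f (kappa) = p + q (kappa - 1) + ... expands to p + q t + ...,
   and dividing by 1 - e^t gives - p / t + (p / 2 - q) + ... *)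
Definition ct (f : nat -> algC) (x : algC) : Prop :=
  exists p, jet (fun k => (1 - k%:R) * f k) p (p / 2 - x).

Lemma ct_unique f x y : ct f x -> ct f y -> x = y.
Proof.
by move=> [p hp] [q hq]; have [-> /addrI /oppr_inj] := jet_unique hp hq.
Qed.

Lemma eq_ct f g x : (forall k, (1 < k)%N -> f k = g k) -> ct f x -> ct g x.
Proof. by move=> fg [p hp]; exists p; apply: eq_jet hp => k k1; rewrite fg. Qed.

Lemma ctD f g x y : ct f x -> ct g y -> ct (fun k => f k + g k) (x + y).
Proof.
move=> [p hp] [q hq]; exists (p + q).
have := jetD hp hq; rewrite (_ : p / 2 - x + _ = (p + q) / 2 - (x + y)); last by field.
by apply: eq_jet => k _; rewrite mulrDr.
Qed.

Lemma ct0 : ct (fun _ => 0) 0.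
Proof.
exists 0; rewrite mul0r subr0; apply: eq_jet (jet_cst 0) => k _.
by rewrite mulr0.
Qed.

Lemma ct_sum (I : Type) (s : seq I) (P : pred I) (f : I -> nat -> algC) (x : I -> algC) :
  (forall i, P i -> ct (f i) (x i)) ->
  ct (fun k => \sum_(i <- s | P i) f i k) (\sum_(i <- s | P i) x i).
Proof.
move=> h; elim: s => [|i s IH].
  by rewrite big_nil; apply: eq_ct ct0 => k _; rewrite big_nil.
rewrite big_cons; case: ifP => Pi.
  by apply: eq_ct (ctD (h i Pi) IH) => k _; rewrite big_cons Pi.
by apply: eq_ct IH => k _; rewrite big_cons Pi.
Qed.

Lemma ct_exprz (h : int) : ct (fun k => k%:R ^ h) 1.
Proof.
exists 0; have := jetM (jetD (jet_cst 1) (jetM (jet_cst (-1)) (jet_exprz 1))) (jet_exprz h).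
rewrite (_ : (1 + -1 * 1) * 1 = 0); last by ring.
rewrite (_ : _ * h%:~R + _ = 0 / 2 - 1); last by rewrite -[1%:~R]/1; field.
by apply: eq_jet => k _; rewrite expr1z mulN1r.
Qed.

(** With Q(h) = (1 - kappa^h) / (1 - kappa), the function times 1 - kappa is (Q(h4) - Q(h3)) /
    (Q(h1) Q(h2)), which is regular at 1. *)
Lemma ct_simple_term (h1 h2 h3 h4 : int) : h1 != 0 -> h2 != 0 ->
  ct (fun k => (k%:R ^ h3 - k%:R ^ h4) / ((1 - k%:R ^ h1) * (1 - k%:R ^ h2)))
     ((h4%:~R - h3%:~R) * (h1%:~R + h2%:~R - h3%:~R - h4%:~R) / (2 * h1%:~R * h2%:~R)).
Proof.
move=> h1_0 h2_0.
have pw (k : nat) (h : int) : (1 < k)%N -> h != 0 -> 1 - k%:R ^ h != 0 :> algC.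
  move=> k1 h0; rewrite subr_eq0 eq_sym pexprz_eq1 ?ler0n //.
  by rewrite (negbTE h0) pnatr_eq1 gtn_eqF.
have q0 (h : int) : h != 0 ->
    forall k, (1 < k)%N -> (1 - k%:R ^ h) / (1 - k%:R) != 0 :> algC.
  by move=> h0 k k1; rewrite mulf_neq0 ?pw // invr_eq0 natr_gt1_neq0.
have h1Q : h1%:~R != 0 :> algC by rewrite intr_eq0.
have h2Q : h2%:~R != 0 :> algC by rewrite intr_eq0.
have := jetM (jetD (jet_quotient h4) (jetM (jet_cst (-1)) (jet_quotient h3)))
  (jetM (jetV (q0 _ h1_0) h1Q (jet_quotient h1)) (jetV (q0 _ h2_0) h2Q (jet_quotient h2))).
set p := (X in jet _ X _) => H; exists p; move: H.
rewrite (_ : _ * (_ + _) + _ = p / 2 - (h4%:~R - h3%:~R) *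
  (h1%:~R + h2%:~R - h3%:~R - h4%:~R) / (2 * h1%:~R * h2%:~R)); last first.
  by rewrite /p; field; rewrite h1Q h2Q.
apply: eq_jet => k k1; have d1 := pw k _ k1 h1_0; have d2 := pw k _ k1 h2_0.
have d := natr_gt1_neq0 k1.
by field; rewrite d d1 d2.
Qed.

(** * Counting solutions *)

Lemma denumerant_size (n a b c : nat) (s : seq (nat * nat * nat)) :
  (0 < a)%N -> (0 < b)%N -> (0 < c)%N -> uniq s ->
  (forall x y z, ((x, y, z) \in s) = (a * x + b * y + c * z == n)%N) ->
  denumerant n a b c = size s.
Proof.
move=> a0 b0 c0 us ms; rewrite /denumerant cardE.
pose f (x : 'I_n.+1 * 'I_n.+1 * 'I_n.+1) : nat * nat * nat :=
  (val x.1.1, val x.1.2, val x.2).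
rewrite -(size_map f); apply/perm_size/uniq_perm => //.
  rewrite map_inj_uniq ?enum_uniq // => -[[x y] z] [[x' y'] z'] [] /=.
  by move=> /val_inj -> /val_inj -> /val_inj ->.
move=> [[x y] z]; rewrite ms; apply/mapP/eqP => [[[[x' y'] z']]|e].
  by rewrite mem_enum inE /= => /eqP e [-> -> ->].
have [hx hy hz] := denumerant_range a0 b0 c0 e.
by exists (Ordinal hx, Ordinal hy, Ordinal hz) => //; rewrite mem_enum inE /= e.
Qed.

(** The value of [gen2] at y = z = 1. *)
Definition count2 (a b m : nat) : nat :=
  \sum_(x < (m %/ a).+1 | (b %| m - a * x)%N) 1.

(** Since c is invertible modulo g, the third unknown is i + g k; dividing by g leaves a x + b y =
    n' - k c, and k < s says that the right side is non-negative. *)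
Lemma denumerant_reduced (n a b c g i s : nat) (n' : int) :
  (0 < a)%N -> (0 < b)%N -> (0 < c)%N -> (0 < g)%N -> coprime c g -> (i < g)%N ->
  n%:Z = g%:Z * n' + (i * c)%N%:Z ->
  (forall k, (k < s)%N = ((k * c)%N%:Z <= n')) ->
  denumerant n (g * a) (g * b) c =
  (\sum_(k < s) count2 a b `|n' - (k * c)%N%:Z|)%N.
Proof.
move=> a0 b0 c0 g0 cg ig nE sP.
pose m k := `|n' - (k * c)%N%:Z|%N.
pose xs k := [seq x <- iota 0 (m k %/ a).+1 | (b %| m k - a * x)%N].
pose L := [seq (x, (m k - a * x) %/ b, i + g * k)%N | k <- iota 0 s, x <- xs k].
rewrite (@denumerant_size _ _ _ _ L) ?muln_gt0 ?g0 //.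
- rewrite size_allpairs_dep sumnE big_map.
  rewrite -[in LHS](subn0 s) -/(index_iota 0 s) big_mkord; apply: eq_bigr => k _.
  rewrite /count2 -/(m k) size_filter -sum1_count.
  by rewrite -[X in iota 0 X](subn0 _) -/(index_iota 0 _) big_mkord.
- apply: allpairs_uniq_dep; first exact: iota_uniq.
    by move=> k _; rewrite filter_uniq ?iota_uniq.
  move=> [k x] [k' x'] _ _ /= [-> _ /addnI /eqP].
  by rewrite eqn_pmul2l // => /eqP ->.
move=> x y z; apply/allpairsPdep/eqP => [[k [x0 []]]|e].
  rewrite mem_iota add0n sP => /= kc; rewrite mem_filter mem_iota add0n ltnS /=.
  case/andP => /dvdnP[q qE]; rewrite leq_divRL // => xm [-> -> ->].
  rewrite qE mulnK //; have mE : (m k)%:Z = n' - (k * c)%N%:Z by rewrite /m; lia.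
  apply/eqP; rewrite -eqz_nat; apply/eqP; rewrite nE.
  have -> : n' = (m k)%:Z + (k * c)%N%:Z by rewrite mE; ring.
  have -> : m k = (q * b + a * x0)%N by lia.
  by rewrite !(PoszD, PoszM); ring.
have zi : (z %% g = i)%N.
  have /dvdzP[q qE] : (g%:Z %| z%:Z - i%:Z)%Z.
    rewrite -(@Gauss_dvdzr _ c); last by rewrite coprimezE /= coprime_sym.
    apply/dvdzP; exists (n' - (a * x)%N%:Z - (b * y)%N%:Z).
    move/(congr1 Posz): e; rewrite nE !(PoszD, PoszM) => /eqP.
    rewrite -subr_eq0 => /eqP h; apply/eqP; rewrite -subr_eq0; apply/eqP.
    by rewrite -[RHS]h; ring.
  (* A negative q would make z = q g + i negative, because i < g. *)
  have [q' q'E] : exists q' : nat, q = q' by exists `|q|%N; nia.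
  have -> : z = (q' * g + i)%N by nia.
  by rewrite modnMDl modn_small.
pose k := (z %/ g)%N; have zE : z = (i + g * k)%N.
  by rewrite {1}(divn_eq z g) zi addnC mulnC.
have axby : (a * x + b * y)%N%:Z = n' - (k * c)%N%:Z.
  have gz : g%:Z != 0 by lia.
  apply: (mulfI gz); move/(congr1 Posz): e; rewrite nE zE !(PoszD, PoszM) => h.
  apply/eqP; rewrite -subr_eq0; move/eqP: h; rewrite -subr_eq0 => /eqP h.
  by apply/eqP; rewrite -[RHS]h; ring.
have mE : m k = (a * x + b * y)%N by rewrite /m -axby.
exists k, x; split.
- by rewrite mem_iota add0n sP /=; lia.
- rewrite mem_filter mem_iota add0n ltnS leq_divRL //= mE addKn.
  by rewrite [(x * a)%N]mulnC leq_addr andbT dvdn_mulr.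
- by rewrite mE addKn mulKn // -zE.
Qed.

(** * Cost of the extended Euclidean algorithm *)

Lemma egcd_loop_stop (fuel : nat) (r0 u0 v0 u1 v1 : int) :
  egcd_loop fuel r0 u0 v0 0 u1 v1 = (Some (r0, u0, v0), 1%N).
Proof. by case: fuel. Qed.

Lemma egcd_loop_step (fuel : nat) (r0 u0 v0 r1 u1 v1 : int) res k : r1 != 0 ->
  egcd_loop fuel r1 u1 v1 (r0 %% r1)%Z (u0 - (r0 %/ r1)%Z * u1)
    (v0 - (r0 %/ r1)%Z * v1) = (Some res, k) ->
  egcd_loop fuel.+1 r0 u0 v0 r1 u1 v1 = (Some res, k + 7)%N.
Proof.
move=> /negbTE r1_0 E.
have -> : (k + 7 = 1 + (1 + (1 + (1 + (1 + (1 + (1 + k)))))))%N by lia.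
rewrite /=; apply: bindE; first by [].
by rewrite r1_0; do 6!(apply: bindE; first by []).
Qed.

(* A division step with r1 <= r0 at least halves r0 * r1. *)
Lemma egcd_loopP (x y : int) (fuel m : nat) (r0 r1 : nat) (u0 v0 u1 v1 : int) :
  (r1 <= fuel)%N -> (r1 <= r0)%N -> (r0 * r1 < 2 ^ m)%N ->
  x * u0 + y * v0 = r0 -> x * u1 + y * v1 = r1 ->
  exists u v k, [/\ egcd_loop fuel r0 u0 v0 r1 u1 v1 = (Some (Posz (gcdn r0 r1), u, v), k),
    x * u + y * v = gcdn r0 r1 & (k <= 7 * m + 1)%N].
Proof.
elim: fuel m r0 r1 u0 v0 u1 v1 => [|fuel IH] m r0 r1 u0 v0 u1 v1 hf h01 hm e0 e1.
  move: hf; rewrite leqn0 => /eqP r1_0; subst r1.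
  by exists u0, v0, 1%N; rewrite gcdn0 egcd_loop_stop; split=> //; lia.
case: (posnP r1) => [r1_0|r1_0].
  subst r1; exists u0, v0, 1%N; rewrite gcdn0 egcd_loop_stop; split=> //; lia.
case: m hm => [|m] hm; first by move: hm; rewrite expn0; nia.
have lt2 : (r0 %% r1 < r1)%N by rewrite ltn_mod.
have half : ((r0 %% r1).*2 <= r0)%N.
  have q0 : (0 < r0 %/ r1)%N by rewrite divn_gt0.
  by have := divn_eq r0 r1; nia.
have [|||||u [v [k [E eq kle]]]] := IH m r1 (r0 %% r1)%N u1 v1
  (u0 - (r0 %/ r1)%N%:Z * u1) (v0 - (r0 %/ r1)%N%:Z * v1).
- by lia.
- exact: ltnW.
- by move: hm; rewrite expnS; nia.
- exact: e1.
- transitivity (x * u0 + y * v0 - (r0 %/ r1)%N%:Z * (x * u1 + y * v1)); first by ring.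
  by rewrite e0 e1; have := divn_eq r0 r1; lia.
exists u, v, (k + 7)%N; split.
- rewrite gcdnC -gcdn_modr; apply: egcd_loop_step.
    by rewrite -lt0n.
  by rewrite modz_nat divz_nat.
- by rewrite eq gcdn_modr gcdnC.
- by lia.
Qed.

(** The first division is done separately: afterwards both entries are at most y, so the cost
    depends on log y only. This matters for the inverse of c modulo g, as c may be much larger than
    b. *)
Lemma ext_gcdP (x y : nat) : (0 < y <= x)%N ->
  exists u v k, [/\ ext_gcd x y = (Some (Posz (gcdn x y), u, v), k),
    x%:Z * u + y%:Z * v = gcdn x y & (k <= 14 * trunc_log 2 y + 22)%N].
Proof.
case/andP=> y0 yx; rewrite /ext_gcd absz_nat; case: y y0 yx => // y y0 yx.
have rlt := ltn_pmod x y0.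
have [|||||u [v [k [E eq kle]]]] := @egcd_loopP x y.+1 y (2 * (trunc_log 2 y.+1).+1)
  y.+1 (x %% y.+1) 0 1 (1 - (x %/ y.+1)%N%:Z * 0) (0 - (x %/ y.+1)%N%:Z * 1).
- by rewrite -ltnS.
- exact: ltnW.
- have := trunc_log_ltn y.+1 (isT : (1 < 2)%N).
  rewrite mul2n -addnn expnD; move: (2 ^ _)%N rlt => T; move: (x %% y.+1)%N => r; nia.
- by ring.
- by have := divn_eq x y.+1; lia.
exists u, v, (k + 7)%N; split.
- rewrite gcdnC -gcdn_modr; apply: egcd_loop_step; first by [].
  by rewrite modz_nat divz_nat.
- by rewrite eq gcdn_modr gcdnC.
- by lia.
Qed.

(** If v = 0, then a u = g <= a forces u = 1, and u - b / g is non-zero because b / g > 1. If u = 0,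
    then b v = g, impossible as 0 < g <= a < b. *)
Lemma bezout_nzP (a b : nat) : (0 < a < b)%N ->
  exists u v k, [/\ bezout_nz a b = (Some (Posz (gcdn a b), u, v), k),
    a%:Z * u + b%:Z * v = gcdn a b, u != 0, v != 0 & (k <= 14 * trunc_log 2 a + 27)%N].
Proof.
case/andP=> a0 ab; have [|v [u [k [E eq kle]]]] := @ext_gcdP b a; first by rewrite a0 ltnW.
rewrite gcdnC in E eq *; set g := gcdn a b in E eq *.
have g0 : (0 < g)%N by rewrite gcdn_gt0 a0.
have ga : (g %| a)%N by exact: dvdn_gcdl.
have gb : (g %| b)%N by exact: dvdn_gcdr.
have gle : (g <= a)%N by exact: dvdn_leq.
case: (eqVneq v 0) => v0.
  have au : a%:Z * u = g by move: eq; rewrite v0 mulr0 add0r.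
  have u1 : u = 1.
    by move: au; clear -g0 gle; case: u => -[|[|u]]; nia.
  exists (u - (b %/ g)%N%:Z), (v + (a %/ g)%N%:Z); eexists; split.
  - apply: bindE; first exact: E.
    apply: bindE; first by [].
    rewrite v0 eqxx.
    by do 4!(apply: bindE; first by rewrite ?divz_nat).
  - have cross : a%:Z * (b %/ g)%N%:Z = b%:Z * (a %/ g)%N%:Z.
      by rewrite -!PoszM -muln_divCA_gcd.
    by rewrite -[RHS]eq mulrBr cross mulrDr; ring.
  - have : (1 < b %/ g)%N by rewrite ltn_divRL // mul1n; lia.
    by rewrite u1; lia.
  - have : (0 < a %/ g)%N by rewrite divn_gt0.
    by rewrite v0; lia.
  - by lia.
exists u, v; eexists; split.
- apply: bindE; first exact: E.
  apply: bindE; first by [].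
  by rewrite (negbTE v0).
- by rewrite -eq addrC.
- by apply/eqP => u0; move: eq; rewrite u0; case: v v0 {E} => [[|v]|v]; nia.
- by [].
- by lia.
Qed.

(** * Correctness of the algorithm *)

Lemma reduce_inputP (n a b c : nat) :
  (0 < a)%N -> (a < b)%N -> (b < c)%N -> gcdn (gcdn a b) c = 1%N ->
  exists (u v n' : int) (a' b' g i k : nat),
  [/\ reduce_input n a b c = (Some (u, v, n', Posz a', Posz b'), k) /\
        (k <= 28 * trunc_log 2 b + 60)%N,
      [/\ u != 0, v != 0 & u * a'%:Z + v * b'%:Z = 1],
      [/\ a = (g * a')%N, b = (g * b')%N & [/\ (0 < g)%N, (0 < a')%N & (0 < b')%N]],
      coprime c g /\ (i < g)%N &
      n%:Z = g%:Z * n' + (i * c)%N%:Z].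
Proof.
move=> a0 ab bc; set g := gcdn a b => cg.
have g0 : (0 < g)%N by rewrite gcdn_gt0 a0.
have ga : (g %| a)%N by exact: dvdn_gcdl.
have gb : (g %| b)%N by exact: dvdn_gcdr.
have gle : (g <= a)%N by exact: dvdn_leq.
have [|u [v [k1 [E1 eq1 u0 v0 k1le]]]] := @bezout_nzP a b; first by rewrite a0.
have [|c3 [w [k2 [E2 eq2 k2le]]]] := @ext_gcdP c g.
  by rewrite g0 (leq_trans gle) // ltnW // (ltn_trans ab).
move: eq2; rewrite gcdnC cg => eq2.
have [i iE ig] : exists2 i : nat, (n%:Z * c3 %% g%:Z)%Z = i & (i < g)%N.
  have gz : g%:Z != 0 by lia.
  have := modz_ge0 (n%:Z * c3) gz; have := ltz_pmod (n%:Z * c3) (g0 : 0 < g%:Z).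
  by case: (_ %% _)%Z => // i lti _; exists i.
pose q := (n%:Z * c3 %/ g%:Z)%Z.
(* The relation c c3 + g w = 1 makes the division by g exact with an explicit quotient. *)
have nE : n%:Z - i%:Z * c%:Z = (n%:Z * w + q * c%:Z) * g%:Z.
  have := divz_eq (n%:Z * c3) g%:Z; rewrite iE -/q => h.
  have -> : i%:Z = n%:Z * c3 - q * g%:Z by rewrite h; ring.
  transitivity (n%:Z * (c%:Z * c3 + g%:Z * w) - (n%:Z * c3 - q * g%:Z) * c%:Z); last by ring.
  by rewrite eq2 mulr1.
exists u, v, (n%:Z * w + q * c%:Z), (a %/ g)%N, (b %/ g)%N, g, i.
eexists; split.
- split.
    apply: bindE; first exact: E1.
    apply: bindE; first exact: E2.
    do 4!(apply: bindE; first by []).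
    rewrite iE nE mulzK; last by lia.
    do 3!(apply: bindE; first by rewrite ?divz_nat).
    by [].
  by have := leq_trunc_log 2 (ltnW ab); have := leq_trunc_log 2 gle; lia.
- split=> //; apply: (mulfI (_ : g%:Z != 0)); first by lia.
  rewrite mulr1 -[RHS]eq1 -{2}(divnK ga) -{2}(divnK gb) !PoszM.
  by ring.
- split; [by rewrite mulnC divnK|by rewrite mulnC divnK|].
  by rewrite g0 !divn_gt0 // gle (leq_trans gle (ltnW ab)).
- by split=> //; rewrite /coprime gcdnC cg.
- by rewrite PoszM mulrC -nE subrK.
Qed.

(** Here s is the floor of n' / c plus 1; for negative n' it is 0 and the sums over k < s are
    empty. *)
Lemma choose_sP (n' : int) (c : nat) : (0 < c)%N -> - c%:Z < n' ->
  exists s : nat, choose_s n' c = (Some (Posz s, (s * c)%N%:Z - n'), 4%N) /\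
    forall k, (k < s)%N = ((k * c)%N%:Z <= n').
Proof.
move=> c0 n'c; have c0' : 0 < c%:Z by [].
have q1 : -1 <= (n' %/ c)%Z by rewrite lez_divRL //; lia.
have [s sE] : exists s : nat, (n' %/ c)%Z + 1 = s.
  by exists `|((n' %/ c)%Z + 1)%R|%N; lia.
exists s; split; first by rewrite /choose_s /bind /= sE PoszM.
by move=> k; rewrite PoszM -lez_divRL // -ltz_nat -sE; lia.
Qed.

Lemma dot_vec3 (x y z : rat) (mu : 'rV[rat]_3) :
  dot (vec3 x y z) mu = x * mu 0 0 + y * mu 0 1 + z * mu 0 2.
Proof.
rewrite /dot !big_ord_recl big_ord0 !mxE /= addr0 addrA.
by congr (_ * mu 0 _ + _ * mu 0 _ + _ * mu 0 _); apply: val_inj.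
Qed.

Definition term_contribution (mu : 'rV[rat]_3) (t : term) : rat :=
  (dot (t_m2 t) mu - dot (t_m1 t) mu) *
  (dot (t_omega t) mu + dot (t_theta t) mu - dot (t_m1 t) mu - dot (t_m2 t) mu) /
  (2%:R * dot (t_omega t) mu * dot (t_theta t) mu).

Lemma evaluateP (mu : 'rV[rat]_3) (ts : seq term) : all (nondeg mu) ts ->
  exists2 k, (k <= 33 * size ts)%N &
  evaluate mu ts = (Some (\sum_(t <- ts) term_contribution mu t), k).
Proof.
elim: ts => [|t ts IH] /=; first by exists 0%N; rewrite ?big_nil.
case/andP=> /andP[/negbTE om /negbTE th] /IH[k kle E].
eexists; last first.
  apply: bindE; first by [].
  apply: bindE; first by [].
  rewrite om; apply: bindE; first by [].
  apply: bindE; first by [].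
  rewrite th; do 3!(apply: bindE; first by []).
  apply: bindE; first exact: E.
  by rewrite big_cons.
by rewrite mulnS /=; lia.
Qed.

(** The z2 and z3 coordinates of the two vectors are (-a, 0) and (-c v, 1), a triangular system. *)
Lemma vec3_indep_a (u v : int) (a c : nat) (N1 N2 : monomial) :
  (0 < a)%N ->
  F_indep (MkF (Posz a, vec3 v%:~R^-1 0 0) (vec3 (u%:~R / v%:~R) 1 0)
            (c%:Z * v, vec3 0 0 1) N1 N2).
Proof.
move=> a0 x y; rewrite /Fomega /Ftheta /= => h.
have := congr1 (fun w : 'rV[rat]_3 => w 0 2) h.
have := congr1 (fun w : 'rV[rat]_3 => w 0 1) h.
rewrite !mxE /= !(mulr0, mulr1, subr0, sub0r, addr0, add0r) => h1 y0.
rewrite y0 mul0r addr0 in h1; split=> //; apply/eqP; move/eqP: h1.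
by rewrite mulrN oppr_eq0 mulf_eq0 pnatr_eq0 (gtn_eqF a0) orbF.
Qed.

Lemma vec3_indep_b (u v : int) (b c : nat) (N1 N2 : monomial) :
  (0 < b)%N ->
  F_indep (MkF (Posz b, vec3 0 u%:~R^-1 0) (vec3 1 (v%:~R / u%:~R) 0)
            (c%:Z * u, vec3 0 0 1) N1 N2).
Proof.
move=> b0 x y; rewrite /Fomega /Ftheta /= => h.
have := congr1 (fun w : 'rV[rat]_3 => w 0 2) h.
have := congr1 (fun w : 'rV[rat]_3 => w 0 0) h.
rewrite !mxE /= !(mulr0, mulr1, subr0, sub0r, addr0, add0r) => h1 y0.
rewrite y0 mul0r addr0 in h1; split=> //; apply/eqP; move/eqP: h1.
by rewrite mulrN oppr_eq0 mulf_eq0 pnatr_eq0 (gtn_eqF b0) orbF.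
Qed.

Lemma expandFP (f : Fexpr) (a : nat) : (F_under f).1 = Posz a -> (0 < a)%N ->
  exists ts j, [/\ expandF f = (Some ts, j), (size ts <= (trunc_log 2 a).+1)%N,
    (j <= 23 + 63 * trunc_log 2 a)%N & expansion f ts].
Proof.
move=> aE a0; rewrite /expandF aE absz_nat; apply: (iterRP aE).
by rewrite a0 trunc_log_ltn.
Qed.

Lemma simple_termsP (n a b c : nat) :
  (0 < a)%N -> (a < b)%N -> (b < c)%N -> gcdn (gcdn a b) c = 1%N ->
  exists ts k, [/\ simple_terms n a b c = (Some ts, k),
    (size ts <= 2 * (trunc_log 2 b).+1)%N /\ (k <= 154 * trunc_log 2 b + 122)%N,
    all regular_term ts &
    exists a' b' s (m : nat -> nat),
      denumerant n a b c = (\sum_(k < s) count2 a' b' (m k))%N /\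
      forall e mu, exponential e -> all (nondeg mu) ts ->
      \sum_(t <- ts) tval e mu t =
      \sum_(k < s) e (mu 0 2) ^+ k * gen2 a' b' (e (mu 0 0)) (e (mu 0 1)) (m k)].
Proof.
move=> a0 ab bc cg.
have [u [v [n' [a' [b' [g [i [k0 H]]]]]]]] := reduce_inputP n a0 ab bc cg.
case: H => [[E0 k0le] [u0 v0 uv] [aE bE [g0 a'0 b'0]] [cg' ig] nE].
have c0 : (0 < c)%N by exact: leq_ltn_trans bc.
(* n' may be negative, but the bound i < g keeps s non-negative. *)
have n'c : - c%:Z < n' by nia.
have [s [E1 sP]] := choose_sP c0 n'c.
pose e0 := (s * c)%N%:Z - n'.
pose Fa := MkF (Posz a', vec3 v%:~R^-1 0 0) (vec3 (u%:~R / v%:~R) 1 0)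
            (c%:Z * v, vec3 0 0 1) (- (n' * v), 0) (e0 * v, vec3 0 0 s%:~R).
pose Fb := MkF (Posz b', vec3 0 u%:~R^-1 0) (vec3 1 (v%:~R / u%:~R) 0)
            (c%:Z * u, vec3 0 0 1) (- (n' * u), 0) (e0 * u, vec3 0 0 s%:~R).
have [ta [ka [Ea sza kale [rega deta vala]]]] := @expandFP Fa a' erefl a'0.
have [tb [kb [Eb szb kble [regb detb valb]]]] := @expandFP Fb b' erefl b'0.
have la : (trunc_log 2 a' <= trunc_log 2 b)%N.
  by apply: leq_trunc_log; rewrite (leq_trans _ (ltnW ab)) // aE leq_pmull.
have lb : (trunc_log 2 b' <= trunc_log 2 b)%N.
  by apply: leq_trunc_log; rewrite bE leq_pmull.
exists (ta ++ tb); eexists; split.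
- apply: bindE; first exact: E0.
  apply: bindE; first exact: E1.
  apply: (@bindE _ _ _ _ Fa 6%N); first by [].
  apply: bindE; first exact: Ea.
  apply: (@bindE _ _ _ _ Fb 6%N); first by [].
  by apply: bindE; first exact: Eb.
- by rewrite size_cat; split; lia.
- by rewrite all_cat rega ?regb //; [exact: vec3_indep_b|exact: vec3_indep_a].
exists a', b', s, (fun k => `|n' - (k * c)%N%:Z|%N); split.
  by rewrite aE bE; apply: denumerant_reduced nE sP.
move=> e mu he; rewrite all_cat => /andP[na nb].
rewrite big_cat /= -vala // -valb //.
have [da oa] := deta _ na; have [db _] := detb _ nb.
have vQ : v%:~R != 0 :> rat by rewrite intr_eq0.
have uQ : u%:~R != 0 :> rat by rewrite intr_eq0.
have uvQ : u%:~R * a'%:R + v%:~R * b'%:R = 1 :> rat.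
  by have := congr1 (fun x : int => x%:~R : rat) uv; rewrite intrD !intrM.
have dot0 : dot 0 mu = 0 by rewrite -(scale0r 0) dotZ mul0r.
have vu : v * b'%:Z + u * a'%:Z = 1 by rewrite addrC.
have kn k : (k < s)%N -> (k * c)%N%:Z <= n' by rewrite sP.
rewrite -(avg_truncated he a'0 b'0 _ _ _ kn).
- rewrite -(avg_multiplier he _ _ _ _ _ _ _ a'0 v0 uv).
  rewrite -(avg_multiplier he _ _ _ _ _ _ _ b'0 u0 vu).
  rewrite /Fval /wt /= !dot_vec3 dot0 (exp0 he) !(mul0r, mul1r, addr0, add0r).
  by congr (_ + _); apply: eq_avg => r _; rewrite mulr1 // [mu 0 0 + _]addrC.
(* By u a' + v b' = 1, omega pairs with mu to [b' * mu 0 0 - a' * mu 0 1]. In the two cases after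
   this one the multiplier cancels from [Fdet]. *)
- move: oa; rewrite /Fomega /= dotB dotZ !dot_vec3; apply: contra_neq => h.
  transitivity (- (a'%:R * mu 0 1 - b'%:R * mu 0 0)); last by rewrite h oppr0.
  have vV : v%:~R^-1 = u%:~R * a'%:R / v%:~R + b'%:R :> rat.
    by apply: (mulIf vQ); rewrite mulVf // mulrDl divfK // (mulrC b'%:R) uvQ.
  by rewrite {1}vV -!pmulrn; field.
- move: da; rewrite /Fdet /= !dot_vec3; apply: contra_neq => h; rewrite -[RHS]h.
  by rewrite intrM -!pmulrn; field.
- move: db; rewrite /Fdet /= !dot_vec3; apply: contra_neq => h; rewrite -[RHS]h.
  by rewrite intrM -!pmulrn; field.
Qed.

(* The vectors (1, k, k^2) meet each plane through the origin finitely often. *)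
Lemma exists_nonorthogonal (ws : seq 'rV[rat]_3) : all (fun w => w != 0) ws ->
  exists mu : 'rV[rat]_3, all (fun w => dot w mu != 0) ws.
Proof.
move=> ws0; pose p (w : 'rV[rat]_3) : {poly rat} := \poly_(i < 3) w 0 (inord i).
have p0 w : w != 0 -> p w != 0.
  apply: contra_neq => pw; apply/rowP => i; rewrite mxE.
  have := congr1 (fun q : {poly rat} => q`_i) pw.
  by rewrite coef_poly ltn_ord coef0 inord_val.
have [|k _ hk] := @poly_neq0_nat _ (\prod_(w <- ws) p w).
  by rewrite prodf_seq_neq0; apply/allP => w /(allP ws0) /p0.
exists (\row_i k%:R ^+ i); apply/allP => w wws.
move: hk; rewrite horner_prod prodf_seq_neq0 => /allP /(_ w wws) /=.
rewrite horner_poly; congr (_ != _); apply: eq_bigr => i _.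
by rewrite mxE inord_val.
Qed.

(** The contribution is homogeneous of degree 0 in mu, so scaling by N makes the exponents integral
    without changing it. *)
Lemma ct_tval (N : nat) (mu : 'rV[rat]_3) (t : term) : (0 < N)%N -> nondeg mu t ->
  all (fun w => N%:R * dot w mu \is a Num.int) [:: t_m1 t; t_m2 t; t_omega t; t_theta t] ->
  ct (fun k => tval (fun h => ratpow k (N%:R * h)) mu t)
    (ratr (term_contribution mu t)).
Proof.
move=> N0 /andP[om th] /and5P[/intrP[h3 h3E] /intrP[h4 h4E] /intrP[h1 h1E] /intrP[h2 h2E] _].
have NQ : N%:R != 0 :> rat by rewrite pnatr_eq0 -lt0n.
have h1_0 : h1 != 0 by rewrite -(intr_eq0 rat) -h1E mulf_neq0.
have h2_0 : h2 != 0 by rewrite -(intr_eq0 rat) -h2E mulf_neq0.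
have := ct_simple_term h3 h4 h1_0 h2_0.
rewrite (_ : _ / _ = ratr ((h4%:~R - h3%:~R) * (h1%:~R + h2%:~R - h3%:~R - h4%:~R) /
  (2 * h1%:~R * h2%:~R))); last first.
  by rewrite !(rmorphM, rmorphB, rmorphD, fmorphV) /= !ratr_int rmorph1.
rewrite -h1E -h2E -h3E -h4E.
rewrite (_ : _ / (2 * _ * _) = term_contribution mu t); last first.
  by rewrite /term_contribution; field; rewrite om th NQ.
apply: eq_ct => k k1; have k0 := ltnW k1.
rewrite /tval /wt (ratpow_int k0 h1E) (ratpow_int k0 h2E).
by rewrite (ratpow_int k0 h3E) (ratpow_int k0 h4E).
Qed.

(** Every monomial in kappa has constant term 1, so the solutions are counted. *)
Lemma ct_gen2 (H1 H2 H3 : int) (a b s : nat) (m : nat -> nat) :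
  ct (fun k => \sum_(j < s) (k%:R ^ H3) ^+ j * gen2 a b (k%:R ^ H1) (k%:R ^ H2) (m j))
    (\sum_(j < s) count2 a b (m j))%:R.
Proof.
rewrite natr_sum; apply: ct_sum => j _; rewrite /count2 natr_sum.
have := @ct_sum _ (index_enum 'I_(m j %/ a).+1) (fun x => (b %| m j - a * x)%N)
  (fun x k => k%:R ^ (H3 * j%:Z + H1 * (x : nat)%:Z + H2 * ((m j - a * x) %/ b)%N%:Z))
  (fun=> 1) (fun x _ => ct_exprz _).
apply: eq_ct => k k1; rewrite /gen2 mulr_sumr; apply: eq_bigr => x _.
have k0 : k%:R != 0 :> algC by rewrite pnatr_eq0 -lt0n ltnW.
by rewrite !(expfzDr _ _ k0) -!exprz_exp -!exprnP mulrA.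
Qed.

Theorem theorem4p1 :
  exists C : nat,
  forall n a b c : nat,
    (0 < a)%N -> (a < b)%N -> (b < c)%N -> gcdn (gcdn a b) c = 1%N ->
    (exists mu : 'rV[rat]_3, admissible mu n a b c) /\
    (forall mu : 'rV[rat]_3, admissible mu n a b c ->
       result (algorithm1 mu n a b c) = Some (denumerant n a b c)%:R /\
       (cost (algorithm1 mu n a b c) <= C * trunc_log 2 b)%N).
Proof.
(* With L = [trunc_log 2 b], the cost is at most 154 L + 122 + 33 * 2 (L + 1) = 220 L + 188, and L
   >= 1. *)
exists 408%N => n a b c a0 ab bc cg.
have [ts [k [E [szts kle] reg [a' [b' [s [m [dE vE]]]]]]]] := simple_termsP n a0 ab bc cg.
split.
  have [|mu] := @exists_nonorthogonal ([seq t_omega t | t <- ts] ++ [seq t_theta t | t <- ts]).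
    rewrite all_cat !all_map -all_predI; apply: sub_all reg => t; exact.
  rewrite all_cat !all_map -all_predI => hmu; exists mu; exists ts; first by rewrite E.
  by apply: sub_all hmu => t.
move=> mu [ts']; rewrite E => -[<-] nts.
have [k' k'le E'] := evaluateP nts.
rewrite /algorithm1 (@bindE _ _ _ (evaluate mu) _ _ _ _ E E').
have b1 : (0 < trunc_log 2 b)%N by rewrite trunc_log_gt0 //= (leq_ltn_trans a0 ab).
split; last by rewrite /=; lia.
congr Some.
(* The coordinates of mu are included so that the generating polynomial also has integral
   exponents. *)
pose cs := [:: mu 0 0; mu 0 1; mu 0 2] ++ [seq dot (t_m1 t) mu | t <- ts] ++
  [seq dot (t_m2 t) mu | t <- ts] ++ [seq dot (t_omega t) mu | t <- ts] ++
  [seq dot (t_theta t) mu | t <- ts].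
have [N N0] := common_denominator cs.
rewrite !all_cat !all_map -!all_predI.
case/andP=> /and4P[/intrP[H1 H1E] /intrP[H2 H2E] /intrP[H3 H3E] _] hN.
pose e k := fun h => ratpow k (N%:R * h).
have ctL : ct (fun k => \sum_(t <- ts) tval (e k) mu t)
    (\sum_(t <- ts) ratr (term_contribution mu t)).
  have hts : all (fun t => nondeg mu t && all (fun w => N%:R * dot w mu \is a Num.int)
      [:: t_m1 t; t_m2 t; t_omega t; t_theta t]) ts.
    rewrite all_predI [all _ _]nts /=; apply: sub_all hN => t /=.
    by rewrite andbT.
  rewrite -(all_filterP hts) big_filter.
  have := @ct_sum _ ts _ (fun t k => tval (e k) mu t)
    (fun t => ratr (term_contribution mu t))
    (fun t ht => ct_tval N0 (andP ht).1 (andP ht).2).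
  by apply: eq_ct => j _; rewrite big_filter.
(* Both numbers are compared in [algC], as constant terms of one function of kappa. *)
apply: (fmorph_inj (ratr : {rmorphism rat -> algC})); rewrite rmorph_sum rmorph_nat /=.
apply: ct_unique ctL _; rewrite dE.
apply: eq_ct (ct_gen2 H1 H2 H3 a' b' s m) => j j1; have j0 := ltnW j1.
rewrite (vE (e j)) //; last exact: ratpow_exponential.
by rewrite /e (ratpow_int j0 H1E) (ratpow_int j0 H2E) (ratpow_int j0 H3E).
Qed.
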